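(* Let $\mathfrak R$ and $\mathfrak S$ be complete, separated two-sided linear topological rings with countable bases of neighborhoods of zero, and let $\mathfrak f\colon\mathfrak R\to\mathfrak S$ be a left proflat continuous ring map. Assume further that $\mathfrak f$ is a topological ring proepimorphism and that the forgetful functor $\mathfrak R\text{-}\mathsf{Contra}\to\mathfrak R\text{-}\mathsf{Mod}$ is fully faithful. Then the functor $\mathfrak f_\sharp\colon\mathfrak S\text{-}\mathsf{Contra}\to\mathfrak R\text{-}\mathsf{Contra}$ is fully faithful, and a left $\mathfrak R$-contramodule $\mathfrak Q$ belongs to its essential image if and only if the underlying left $\mathfrak R$-module structure of $\mathfrak Q$ arises from some left $\mathfrak S$-module structure; such an $\mathfrak S$-module structure is necessarily unique. The commutative square of forgetful functors $$\begin{array}{ccc}\mathfrak S\text{-}\mathsf{Contra}&\longrightarrow&\mathfrak S\text{-}\mathsf{Mod}\\ {\scriptstyle\mathfrak f_\sharp}\downarrow&&\downarrow{\scriptstyle\mathfrak f_*}\\ \mathfrak R\text{-}\mathsf{Contra}&\longrightarrow&\mathfrak R\text{-}\mathsf{Mod}\end{array}$$ is a pseudopullback diagram in which the two horizontal functors and the functor $\mathfrak f_\sharp$ are fully faithful.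
   Context: All rings are associative and unital, and ring maps are unital ring homomorphisms. A topological ring is two-sided linear if open two-sided ideals form a base of neighborhoods of zero; it is complete and separated if the natural map to the projective limit of its quotients by all open subgroups is bijective. For a ring map $\mathfrak f\colon\mathfrak R\to\mathfrak S$ and $\mathfrak I\subset\mathfrak R$, $\mathfrak f(\mathfrak I)\mathfrak S$ is the right ideal generated by $\mathfrak f(\mathfrak I)$. The map $\mathfrak f$ is strongly right taut if those open two-sided ideals $\mathfrak I\subset\mathfrak R$ for which the closure of $\mathfrak f(\mathfrak I)\mathfrak S$ in $\mathfrak S$ is an open two-sided ideal of $\mathfrak S$ form a base of neighborhoods of zero in $\mathfrak R$. A strongly right taut continuous $\mathfrak f$ is left proflat if for every open two-sided ideal $\mathfrak I\subset\mathfrak R$ such that the closure $\mathfrak J$ of $\mathfrak f(\mathfrak I)\mathfrak S$ is an open two-sided ideal in $\mathfrak S$, the ring $\mathfrak S/\mathfrak J$ is a flat left $\mathfrak R/\mathfrak I$-module. (So left proflat maps are by definition continuous and strongly right taut.) A continuous $\mathfrak f$ is a topological ring proepimorphism if, for all open two-sided ideals $\mathfrak I\subset\mathfrak R$ and $\mathfrak J\subset\mathfrak S$ with $\mathfrak f(\mathfrak I)\subset\mathfrak J$, the induced map $\mathfrak R/\mathfrak I\to\mathfrak S/\mathfrak J$ is an epimorphism in the category of associative unital rings. Contramodules. For a set $X$, let $\mathfrak R[[X]]$ be the set of all infinite formal linear combinations $\sum_{x\in X}r_xx$ whose coefficient families $(r_x\in\mathfrak R)_{x\in X}$ converge to zero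 (for every open subgroup $\mathfrak U\subset\mathfrak R$, $r_x\in\mathfrak U$ for all but finitely many $x$). A map $g\colon X\to Y$ induces $\mathfrak R[[g]]\colon\sum_x r_xx\mapsto\sum_y\bigl(\sum_{g(x)=y}r_x\bigr)y$, where infinite sums in $\mathfrak R$ are limits of finite partial sums. The functor $\mathfrak R[[-]]$ is a monad on sets with unit $\epsilon_X\colon x\mapsto 1\cdot x$ and multiplication $\phi_X\colon\mathfrak R[[\mathfrak R[[X]]]]\to\mathfrak R[[X]]$ given by opening parentheses. A left $\mathfrak R$-contramodule is a module (algebra) over this monad, i.e. a set $\mathfrak P$ with a map $\pi_{\mathfrak P}\colon\mathfrak R[[\mathfrak P]]\to\mathfrak P$ satisfying $\pi_{\mathfrak P}\epsilon_{\mathfrak P}=\mathrm{id}$ and $\pi_{\mathfrak P}\circ\mathfrak R[[\pi_{\mathfrak P}]]=\pi_{\mathfrak P}\circ\phi_{\mathfrak P}$. These form an abelian category $\mathfrak R\text{-}\mathsf{Contra}$. Restricting $\pi_{\mathfrak P}$ to finite linear combinations gives the forgetful functor $\mathfrak R\text{-}\mathsf{Contra}\to\mathfrak R\text{-}\mathsf{Mod}$ to left $\mathfrak R$-modules. Functors. A continuous $\mathfrak f$ induces maps $\mathfrak R[[X]]\to\mathfrak S[[X]]$; precomposing $\pi_{\mathfrak Q}\colon\mathfrak S[[\mathfrak Q]]\to\mathfrak Q$ with $\mathfrak R[[\mathfrak Q]]\to\mathfrak S[[\mathfrak Q]]$ defines the restriction of scalars $\mathfrak f_\sharp\colon\mathfrak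 S\text{-}\mathsf{Contra}\to\mathfrak R\text{-}\mathsf{Contra}$. $\mathfrak f_*$ is the usual restriction of scalars on left modules. Given functors $F\colon\mathsf A\to\mathsf C$ and $G\colon\mathsf B\to\mathsf C$, their pseudopullback $\mathsf P$ is the category of triples $(A,B,\phi)$ with $A\in\mathsf A$, $B\in\mathsf B$ and $\phi\colon F(A)\simeq G(B)$ an isomorphism in $\mathsf C$ (with the obvious morphisms). A square of functors $\mathsf D\to\mathsf A\xrightarrow{F}\mathsf C$, $\mathsf D\to\mathsf B\xrightarrow{G}\mathsf C$ commuting up to a fixed natural isomorphism is a pseudopullback diagram if the induced comparison functor $\mathsf D\to\mathsf P$ is an equivalence of categories. *)

(* Defs.v *)
From HB Require Import structures.
From mathcomp Require Import all_boot all_algebra finmap generic_quotient.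
From mathcomp Require Import boolp classical_sets functions cardinality.
From mathcomp Require Import topology tvs.
From mathcomp Require summability.

Set Implicit Arguments.
Unset Strict Implicit.
Unset Printing Implicit Defensive.

Import GRing.Theory.
Local Open Scope classical_set_scope.
Local Open Scope ring_scope.

Definition is_subgroup (A : zmodType) (U : set A) : Prop :=
  U 0 /\ forall x y, U x -> U y -> U (x - y).

Definition is_right_ideal (R : pzRingType) (K : set R) : Prop :=
  is_subgroup K /\ forall x a, K x -> K (x * a).

Definition is_ideal2 (R : pzRingType) (I : set R) : Prop :=
  is_subgroup I /\ forall a x, I x -> I (a * x) /\ I (x * a).

Definition add_coset (A : zmodType) (U : set A) (a : A) : set A :=
  [set x | U (x - a)].

HB.mixin Record TopologicalZmodule_isTopologicalRing R
    of TopologicalZmodule R & GRing.PzRing R := {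
  mul_continuous : continuous (fun x : R * R => x.1 * x.2)
}.

#[short(type="topologicalRingType")]
HB.structure Definition TopologicalRing :=
  {R of TopologicalZmodule R & GRing.PzRing R
        & TopologicalZmodule_isTopologicalRing R}.

Definition open_subgroup (R : topologicalRingType) (U : set R) : Prop :=
  open U /\ is_subgroup U.

Definition open_ideal2 (R : topologicalRingType) (I : set R) : Prop :=
  open I /\ is_ideal2 I.

Definition nbhs0_base (R : topologicalRingType) (B : set (set R)) : Prop :=
  (forall V, B V -> nbhs 0 V) /\
  (forall U, nbhs 0 U -> exists2 V, B V & V `<=` U).

(* A point of the projective limit of the quotient groups R/U over all open
   subgroups U, the element of R/U being given as a subset of R. *)
Definition proj_lim_point (R : topologicalRingType) (C : set R -> set R) :=
  (forall U, open_subgroup U -> exists a, C U = add_coset U a) /\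
  (forall U V, open_subgroup U -> open_subgroup V ->
     V `<=` U -> C V `<=` C U).

HB.mixin Record TopologicalRing_isCompleteLinear R of TopologicalRing R := {
  two_sided_linear : nbhs0_base [set I : set R | open_ideal2 I];
  complete_separated : forall C : set R -> set R, proj_lim_point C ->
    exists! x : R, forall U, open_subgroup U -> C U = add_coset U x
}.

#[short(type="clinearRingType")]
HB.structure Definition CompleteLinearRing :=
  {R of TopologicalRing R & TopologicalRing_isCompleteLinear R}.

Definition has_countable_base (R : topologicalRingType) : Prop :=
  exists2 B : set (set R), countable B & nbhs0_base B.

Record ideal2 (R : pzRingType) := Ideal2 {
  ideal2_set :> set R;
  ideal2P : is_ideal2 ideal2_set
}.

Section Quotient.
Variables (R : pzRingType) (IR : ideal2 R).
Local Notation I := (ideal2_set IR).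

Lemma ideal0 : I 0. Proof. by case: (ideal2P IR) => -[]. Qed.
Lemma idealB x y : I x -> I y -> I (x - y).
Proof. by case: (ideal2P IR) => -[_ +] _; apply. Qed.
Lemma idealN x : I x -> I (- x).
Proof. by move=> /(idealB ideal0); rewrite sub0r. Qed.
Lemma idealD x y : I x -> I y -> I (x + y).
Proof. by move=> Ix /idealN /(idealB Ix); rewrite opprK. Qed.
Lemma idealMl a x : I x -> I (a * x).
Proof. by move=> Ix; case: (ideal2P IR) => _ /(_ a x Ix)[]. Qed.
Lemma idealMr a x : I x -> I (x * a).
Proof. by move=> Ix; case: (ideal2P IR) => _ /(_ a x Ix)[]. Qed.

Definition ideal_equiv : rel R := fun x y => `[< I (x - y) >].

Lemma ideal_equiv_is_equiv : equiv_class_of ideal_equiv.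
Proof.
split=> [x|x y|y x z].
- by apply/asboolP; rewrite subrr; exact: ideal0.
- by apply/asboolP/asboolP => /idealN; rewrite opprB.
- move=> /asboolP xy /asboolP yz; apply/asboolP.
  by rewrite -(subrKA y); exact: idealD.
Qed.

Canonical ideal_equivR := EquivRelPack ideal_equiv_is_equiv.

Definition quot_ring := {eq_quot ideal_equivR}%qT.
HB.instance Definition _ := Choice.on quot_ring.

Definition quot_pi (x : R) : quot_ring := \pi_quot_ring%qT x.
Definition quot_repr (x : quot_ring) : R := repr x.

Lemma quot_reprK : cancel quot_repr quot_pi. Proof. exact: reprK. Qed.

Lemma quot_piP x y : quot_pi x = quot_pi y <-> I (x - y).
Proof.
split=> [/eqmodP/asboolP //|Ixy]; by apply/eqmodP/asboolP.
Qed.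

Definition quot_zero := quot_pi 0.
Definition quot_one := quot_pi 1.
Definition quot_opp x := quot_pi (- quot_repr x).
Definition quot_add x y := quot_pi (quot_repr x + quot_repr y).
Definition quot_mul x y := quot_pi (quot_repr x * quot_repr y).

Lemma quot_pi_repr x : I (quot_repr (quot_pi x) - x).
Proof. by apply/quot_piP; rewrite quot_reprK. Qed.

Lemma quot_piN x : quot_opp (quot_pi x) = quot_pi (- x).
Proof. by apply/quot_piP; rewrite -opprD; exact/idealN/quot_pi_repr. Qed.

Lemma quot_piD x y : quot_add (quot_pi x) (quot_pi y) = quot_pi (x + y).
Proof.
by apply/quot_piP; rewrite opprD addrACA; apply: idealD; exact: quot_pi_repr.
Qed.

Lemma quot_piM x y : quot_mul (quot_pi x) (quot_pi y) = quot_pi (x * y).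
Proof.
apply/quot_piP; set a := quot_repr _; set b := quot_repr _.
rewrite -(subrKA (a * y)) -mulrBr -mulrBl; apply: idealD.
  exact/idealMl/quot_pi_repr.
exact/idealMr/quot_pi_repr.
Qed.

Let quotW (P : quot_ring -> Prop) : (forall x, P (quot_pi x)) -> forall x, P x.
Proof. by move=> h x; rewrite -(quot_reprK x). Qed.

Lemma quot_addA : associative quot_add.
Proof.
by elim/quotW=> x; elim/quotW=> y; elim/quotW=> z; rewrite !quot_piD addrA.
Qed.
Lemma quot_addC : commutative quot_add.
Proof. by elim/quotW=> x; elim/quotW=> y; rewrite !quot_piD addrC. Qed.
Lemma quot_add0 : left_id quot_zero quot_add.
Proof. by elim/quotW=> x; rewrite quot_piD add0r. Qed.
Lemma quot_addN : left_inverse quot_zero quot_opp quot_add.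
Proof. by elim/quotW=> x; rewrite quot_piN quot_piD addNr. Qed.
HB.instance Definition _ :=
  GRing.isZmodule.Build quot_ring quot_addA quot_addC quot_add0 quot_addN.

Lemma quot_mulA : associative quot_mul.
Proof.
by elim/quotW=> x; elim/quotW=> y; elim/quotW=> z; rewrite !quot_piM mulrA.
Qed.
Lemma quot_mul1 : left_id quot_one quot_mul.
Proof. by elim/quotW=> x; rewrite quot_piM mul1r. Qed.
Lemma quot_1mul : right_id quot_one quot_mul.
Proof. by elim/quotW=> x; rewrite quot_piM mulr1. Qed.
Lemma quot_mulDl : left_distributive quot_mul quot_add.
Proof.
elim/quotW=> x; elim/quotW=> y; elim/quotW=> z.
by rewrite !(quot_piD, quot_piM) mulrDl.
Qed.
Lemma quot_mulDr : right_distributive quot_mul quot_add.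
Proof.
elim/quotW=> x; elim/quotW=> y; elim/quotW=> z.
by rewrite !(quot_piD, quot_piM) mulrDr.
Qed.
HB.instance Definition _ := GRing.Zmodule_isPzRing.Build quot_ring
  quot_mulA quot_mul1 quot_1mul quot_mulDl quot_mulDr.

Lemma quot_pi_zmod_morphism : zmod_morphism quot_pi.
Proof. by move=> x y; rewrite -[RHS]/(quot_add _ (quot_opp _)) quot_piN quot_piD. Qed.
Lemma quot_pi_monoid_morphism : monoid_morphism quot_pi.
Proof. by split=> [//|x y]; rewrite -[RHS]/(quot_mul _ _) quot_piM. Qed.
HB.instance Definition _ :=
  GRing.isZmodMorphism.Build R quot_ring quot_pi quot_pi_zmod_morphism.
HB.instance Definition _ :=
  GRing.isMonoidMorphism.Build R quot_ring quot_pi quot_pi_monoid_morphism.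

End Quotient.

Section QuotientMap.
Variables (R S : pzRingType) (f : {rmorphism R -> S}).
Variables (I : ideal2 R) (J : ideal2 S) (fIJ : f @` I `<=` J).

Definition quot_map of f @` I `<=` J : quot_ring I -> quot_ring J :=
  fun x => quot_pi J (f (quot_repr x)).

Lemma quot_map_pi x : quot_map fIJ (quot_pi I x) = quot_pi J (f x).
Proof.
by apply/quot_piP; rewrite -rmorphB; apply: fIJ; exists (quot_repr (quot_pi I x) - x)
  => //; exact: quot_pi_repr.
Qed.

Lemma quot_map_zmod_morphism : zmod_morphism (quot_map fIJ).
Proof.
move=> x y; rewrite -(quot_reprK x) -(quot_reprK y) -rmorphB.
by rewrite !quot_map_pi !rmorphB.
Qed.
Lemma quot_map_monoid_morphism : monoid_morphism (quot_map fIJ).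
Proof.
split=> [|x y]; first by rewrite -(rmorph1 (quot_pi I)) quot_map_pi !rmorph1.
rewrite -(quot_reprK x) -(quot_reprK y) -rmorphM.
by rewrite !quot_map_pi !rmorphM.
Qed.
HB.instance Definition _ := GRing.isZmodMorphism.Build
  (quot_ring I) (quot_ring J) (quot_map fIJ) quot_map_zmod_morphism.
HB.instance Definition _ := GRing.isMonoidMorphism.Build
  (quot_ring I) (quot_ring J) (quot_map fIJ) quot_map_monoid_morphism.

End QuotientMap.

Definition restr_mod (A B : pzRingType) (f : {rmorphism A -> B})
  (M : lmodType B) : Type := M.

Section RestrMod.
Variables (A B : pzRingType) (f : {rmorphism A -> B}) (M : lmodType B).
HB.instance Definition _ := GRing.Zmodule.on (restr_mod f M).

Definition restr_scale (a : A) (m : restr_mod f M) : restr_mod f M :=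
  f a *: (m : M).
Lemma restr_scaleA a b v :
  restr_scale a (restr_scale b v) = restr_scale (a * b) v.
Proof. by rewrite /restr_scale scalerA rmorphM. Qed.
Lemma restr_scale1 : left_id 1 restr_scale.
Proof. by move=> v; rewrite /restr_scale rmorph1 scale1r. Qed.
Lemma restr_scaleDr : right_distributive restr_scale +%R.
Proof. by move=> a u v; exact: scalerDr. Qed.
Lemma restr_scaleDl v : {morph restr_scale^~ v : a b / a + b}.
Proof. by move=> a b; rewrite /restr_scale rmorphD scalerDl. Qed.
HB.instance Definition _ := GRing.Zmodule_isLmodule.Build A (restr_mod f M)
  restr_scaleA restr_scale1 restr_scaleDr restr_scaleDl.
End RestrMod.

Section RestrHom.
Variables (A B : pzRingType) (f : {rmorphism A -> B}) (M N : lmodType B).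
Variable g : {linear M -> N}.
Definition restr_hom_fun of {linear M -> N} : restr_mod f M -> restr_mod f N :=
  fun m => g m.
Lemma restr_hom_linear : linear (restr_hom_fun g).
Proof. by move=> a u v; exact: (linearP g). Qed.
HB.instance Definition _ := GRing.isLinear.Build A (restr_mod f M)
  (restr_mod f N) *:%R (restr_hom_fun g) restr_hom_linear.
Definition restr_hom : {linear restr_mod f M -> restr_mod f N} :=
  restr_hom_fun g.
End RestrHom.

(* Right A-modules are left modules over the converse ring A^c; n . a is
   written (a : A^c) *: n. *)
Definition balanced (A : pzRingType) (N : lmodType A^c) (M : lmodType A)
    (G : zmodType) (b : N -> M -> G) : Prop :=
  [/\ forall n n' m, b (n + n') m = b n m + b n' m,
      forall n m m', b n (m + m') = b n m + b n m' &
      forall (n : N) (a : A) (m : M), b ((a : A^c) *: n) m = b n (a *: m)].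

Definition is_tensor (A : pzRingType) (N : lmodType A^c) (M : lmodType A)
    (T : zmodType) (t : N -> M -> T) : Prop :=
  balanced t /\
  forall (G : zmodType) (b : N -> M -> G), balanced b ->
    exists! h : {additive T -> G}, forall n m, h (t n m) = b n m.

Definition short_exact (U V W : zmodType) (i : U -> V) (p : V -> W) : Prop :=
  [/\ injective i, forall w, exists v, p v = w &
      forall v, p v = 0 <-> exists u, i u = v].

(* Exactness of - (x)_A M. Tensor products enter through their universal
   property, so iM and pM are i (x)_A M and p (x)_A M. *)
Definition flat (A : pzRingType) (M : lmodType A) : Prop :=
  forall (N' N N'' : lmodType A^c)
         (i : {linear N' -> N}) (p : {linear N -> N''}),
    short_exact i p ->
  forall (T' T T'' : zmodType)
         (t' : N' -> M -> T') (t : N -> M -> T) (t'' : N'' -> M -> T''),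
    is_tensor t' -> is_tensor t -> is_tensor t'' ->
  forall (iM : {additive T' -> T}) (pM : {additive T -> T''}),
    (forall n m, iM (t' n m) = t (i n) m) ->
    (forall n m, pM (t n m) = t'' (p n) m) ->
    short_exact iM pM.

Section RingMaps.
Variables (R S : topologicalRingType) (f : {rmorphism R -> S}).

Definition closed_right_ideal_gen (I : set R) : set S :=
  closure (smallest (@is_right_ideal S) (f @` I)).

Definition strongly_right_taut : Prop :=
  nbhs0_base [set I : set R |
    open_ideal2 I /\ open_ideal2 (closed_right_ideal_gen I)].

Definition left_proflat : Prop :=
  [/\ continuous f, strongly_right_taut &
      forall (I : ideal2 R) (J : ideal2 S) (fIJ : f @` I `<=` J),
        open (I : set R) -> open (J : set S) ->
        J = closed_right_ideal_gen I :> set S ->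
        flat (restr_mod (quot_map fIJ) (quot_ring J)^o)].

Definition ring_epi (A B : pzRingType) (h : {rmorphism A -> B}) : Prop :=
  forall (T : pzRingType) (u v : {rmorphism B -> T}),
    (forall a, u (h a) = v (h a)) -> forall b, u b = v b.

Definition topological_ring_proepi : Prop :=
  continuous f /\
  forall (I : ideal2 R) (J : ideal2 S) (fIJ : f @` I `<=` J),
    open (I : set R) -> open (J : set S) -> ring_epi (quot_map fIJ).

End RingMaps.

#[local] Obligation Tactic := idtac.

Record category := Category {
  obj :> Type;
  hom : obj -> obj -> Type;
  idc : forall x, hom x x;
  compc : forall x y z, hom y z -> hom x y -> hom x z;
  comp1c : forall x y (f : hom x y), compc (idc y) f = f;
  compc1 : forall x y (f : hom x y), compc f (idc x) = f;
  compcA : forall x y z t (h : hom z t) (g : hom y z) (f : hom x y),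
    compc h (compc g f) = compc (compc h g) f
}.
Arguments idc {c} x.
Arguments compc {c x y z} g f.
Arguments hom {c} x y.

Definition is_iso (C : category) (x y : C) (f : hom x y) : Prop :=
  exists g : hom y x, compc g f = idc x /\ compc f g = idc y.

Record functor (C D : category) := Functor {
  fobj :> C -> D;
  fmap : forall x y, hom x y -> hom (fobj x) (fobj y);
  fmap1 : forall x, fmap (idc x) = idc (fobj x);
  fmapM : forall x y z (g : hom y z) (f : hom x y),
    fmap (compc g f) = compc (fmap g) (fmap f)
}.
Arguments fmap {C D} _ {x y} _.

Definition id_functor (C : category) : functor C C :=
  @Functor C C id (fun _ _ => id) (fun _ => erefl) (fun _ _ _ _ _ => erefl).

Program Definition comp_functor (C D E : category)
    (G : functor D E) (F : functor C D) : functor C E :=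
  @Functor C E (fun x => G (F x)) (fun _ _ f => fmap G (fmap F f)) _ _.
Next Obligation. by move=> * /=; rewrite !fmap1. Qed.
Next Obligation. by move=> * /=; rewrite !fmapM. Qed.

Record nat_iso (C D : category) (F G : functor C D) := NatIso {
  ncomp :> forall x, hom (F x) (G x);
  ncomp_natural : forall x y (f : hom x y),
    compc (ncomp y) (fmap F f) = compc (fmap G f) (ncomp x);
  ncomp_iso : forall x, is_iso (ncomp x)
}.

Definition is_equivalence (C D : category) (F : functor C D) : Prop :=
  exists G : functor D C,
    inhabited (nat_iso (comp_functor G F) (id_functor C)) /\
    inhabited (nat_iso (comp_functor F G) (id_functor D)).

Definition fully_faithful (C D : category) (F : functor C D) : Prop :=
  forall x y : C, bijective (fun f : hom x y => fmap F f).

Definition in_essential_image (C D : category) (F : functor C D) (y : D) :=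
  exists (x : C) (f : hom (F x) y), is_iso f.

Section Pseudopullback.
Variables (A B C : category) (F : functor A C) (G : functor B C).

Record ppb_obj := PpbObj {
  ppb_fst : A;
  ppb_snd : B;
  ppb_glue : hom (F ppb_fst) (G ppb_snd);
  ppb_glue_iso : is_iso ppb_glue
}.

Record ppb_hom (x y : ppb_obj) := PpbHom {
  ppb_hom_fst : hom (ppb_fst x) (ppb_fst y);
  ppb_hom_snd : hom (ppb_snd x) (ppb_snd y);
  ppb_hom_square : compc (fmap G ppb_hom_snd) (ppb_glue x) =
                   compc (ppb_glue y) (fmap F ppb_hom_fst)
}.

Lemma ppb_hom_eq x y (f g : ppb_hom x y) :
  ppb_hom_fst f = ppb_hom_fst g -> ppb_hom_snd f = ppb_hom_snd g -> f = g.
Proof.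
case: f g => [f1 f2 f3] [g1 g2 g3] /= e1 e2; subst.
by congr PpbHom; exact: Prop_irrelevance.
Qed.

Program Definition ppb_id x : ppb_hom x x :=
  @PpbHom x x (idc _) (idc _) _.
Next Obligation. by move=> x /=; rewrite !fmap1 comp1c compc1. Qed.

Program Definition ppb_comp x y z (g : ppb_hom y z) (f : ppb_hom x y) :
    ppb_hom x z :=
  @PpbHom x z (compc (ppb_hom_fst g) (ppb_hom_fst f))
              (compc (ppb_hom_snd g) (ppb_hom_snd f)) _.
Next Obligation.
move=> x y z g f.
by rewrite !fmapM -compcA ppb_hom_square !compcA ppb_hom_square.
Qed.

Program Definition pseudopullback : category :=
  @Category ppb_obj ppb_hom ppb_id ppb_comp _ _ _.
Next Obligation. by move=> *; apply: ppb_hom_eq; exact: comp1c. Qed.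
Next Obligation. by move=> *; apply: ppb_hom_eq; exact: compc1. Qed.
Next Obligation. by move=> *; apply: ppb_hom_eq; exact: compcA. Qed.

Variables (D : category) (K : functor D A) (L : functor D B).
Variable alpha : nat_iso (comp_functor F K) (comp_functor G L).

Program Definition ppb_comparison : functor D pseudopullback :=
  @Functor D pseudopullback
    (fun d => @PpbObj (K d) (L d) (alpha d) (ncomp_iso alpha d))
    (fun d e f => @PpbHom _ _ (fmap K f) (fmap L f) _) _ _.
Next Obligation. by move=> d e f; exact/esym/(ncomp_natural alpha). Qed.
Next Obligation. by move=> d; apply: ppb_hom_eq; exact: fmap1. Qed.
Next Obligation. by move=> *; apply: ppb_hom_eq; exact: fmapM. Qed.

Definition is_pseudopullback : Prop := is_equivalence ppb_comparison.

End Pseudopullback.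

Lemma linear_eq (A : pzRingType) (M N : lmodType A) (f g : {linear M -> N}) :
  (forall x, f x = g x) -> f = g.
Proof.
case: f g => [f [[f1] [f2]]] [g [[g1] [g2]]] /= /funext e.
move: f1 f2 g1 g2; rewrite e => f1 f2 g1 g2.
by rewrite (Prop_irrelevance f1 g1) (Prop_irrelevance f2 g2).
Qed.

Program Definition Mod (A : pzRingType) : category :=
  @Category (lmodType A) (fun M N => {linear M -> N})
    (fun M => idfun) (fun _ _ _ g f => g \o f) _ _ _.
Next Obligation. by move=> *; exact: linear_eq. Qed.
Next Obligation. by move=> *; exact: linear_eq. Qed.
Next Obligation. by move=> *; exact: linear_eq. Qed.

Program Definition restr_functor (A B : pzRingType) (f : {rmorphism A -> B}) :
    functor (Mod B) (Mod A) :=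
  @Functor (Mod B) (Mod A) (fun M => restr_mod f M)
    (fun M N g => restr_hom f g) _ _.
Next Obligation. by move=> *; exact: linear_eq. Qed.
Next Obligation. by move=> *; exact: linear_eq. Qed.

Definition is_module_action (A : pzRingType) (V : zmodType)
    (s : A -> V -> V) : Prop :=
  [/\ forall a b v, s a (s b v) = s (a * b) v,
      left_id 1 s,
      right_distributive s +%R &
      forall v, {morph s^~ v : a b / a + b}].

(* s is a B-module structure on the underlying group of the A-module M from
   which the given A-module structure arises by restriction along f. *)
Definition induces_module (A B : pzRingType) (f : {rmorphism A -> B})
    (M : lmodType A) (s : B -> M -> M) : Prop :=
  is_module_action s /\ forall a v, s (f a) v = a *: v.

Section Subgroup.
Variables (A : zmodType) (U : set A) (Usg : is_subgroup U).

Lemma sg0 : U 0. Proof. by case: Usg. Qed.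
Lemma sgB x y : U x -> U y -> U (x - y). Proof. by case: Usg => _; apply. Qed.
Lemma sgN x : U x -> U (- x).
Proof. by move=> /(sgB sg0); rewrite sub0r. Qed.
Lemma sgD x y : U x -> U y -> U (x + y).
Proof. by move=> Ux /sgN /(sgB Ux); rewrite opprK. Qed.
Lemma sg_sym x y : U (x - y) -> U (y - x).
Proof. by move=> /sgN; rewrite opprB. Qed.
Lemma sg_trans y x z : U (x - y) -> U (y - z) -> U (x - z).
Proof. by move=> xy yz; rewrite -(subrKA y); exact: sgD. Qed.
Lemma sg_sum (X : choiceType) (s : {fset X}) (F : X -> A) :
  (forall x, x \in s -> U (F x)) -> U (\sum_(x <- s) F x).
Proof.
move=> h; rewrite big_seq; elim/big_ind: _ => //; [exact: sg0|exact: sgD].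
Qed.
Lemma sg_sumB (X : choiceType) (s : {fset X}) (F G : X -> A) :
  (forall x, x \in s -> U (F x - G x)) ->
  U (\sum_(x <- s) F x - \sum_(x <- s) G x).
Proof. by move=> h; rewrite -sumrB; exact: sg_sum. Qed.
Lemma sg_subset_sum (X : choiceType) (s t : {fset X}) (F : X -> A) :
  (s `<=` t)%fset -> (forall x, x \notin s -> U (F x)) ->
  U (\sum_(x <- t) F x - \sum_(x <- s) F x).
Proof.
move=> st h; pose G x := if x \in s then F x else 0.
have -> : \sum_(x <- s) F x = \sum_(x <- t) G x.
  rewrite -(big_fset_incl _ st); first by
    rewrite big_seq [RHS]big_seq; apply: eq_bigr => x; rewrite /G => ->.
  by move=> x _; rewrite /G => /negbTE ->.
apply: sg_sumB => x _; rewrite /G; case: ifPn => [_|/h]; rewrite ?subr0 //.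
by rewrite subrr; exact: sg0.
Qed.
End Subgroup.

Section NullFamily.
Variable R : clinearRingType.
Implicit Types X Y Z : choiceType.

Definition null_family X (r : X -> R) : Prop :=
  forall U, open_subgroup U -> finite_set [set x | ~ U (r x)].

(* The limit along the filter of finite subsets of X; 0 if there is none. *)
Definition infsum X (r : X -> R) : R :=
  xget 0 [set s | summability.partial_sum r @ summability.totally --> s].

Lemma partial_sumE X (r : X -> R) (A : {fset X}) :
  summability.partial_sum r A = \sum_(x <- A) r x.
Proof. by rewrite [RHS]big_seq_fsetE. Qed.

Lemma open_ideal2_subgroup (I : set R) : open_ideal2 I -> open_subgroup I.
Proof. by move=> [? []]; split. Qed.

Lemma open_subgroup_ideal2 (U : set R) :
  open_subgroup U -> exists2 I, open_ideal2 I & I `<=` U.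
Proof.
move=> [oU sU]; apply: (two_sided_linear (s := R)).2.
by apply: open_nbhs_nbhs; split => //; exact: sg0.
Qed.

Lemma null_family_ideal X (r : X -> R) :
  (forall I, open_ideal2 I -> finite_set [set x | ~ I (r x)]) -> null_family r.
Proof.
move=> h U /open_subgroup_ideal2[I oI IU]; apply: sub_finite_set (h I oI).
by move=> x /= nU /IU.
Qed.

Lemma null_familyP X (r : X -> R) (U : set R) : null_family r ->
  open_subgroup U -> exists A : {fset X}, forall x, x \notin A -> U (r x).
Proof.
move=> nr oU; exists (fset_set [set x | ~ U (r x)]) => x.
rewrite in_fset_set; last exact: nr.
by move=> /negP; rewrite inE; apply: contra_notP.
Qed.

Lemma nbhs_ideal (x : R) (W : set R) : nbhs x W ->
  exists2 I, open_ideal2 I & add_coset I x `<=` W.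
Proof.
move=> Wx.
have c : (fun y : R => y + x) @ (0 : R) --> (0 + x : R).
  apply: (@continuous_comp _ _ _ (fun y : R => (y, x))
    (fun z : R * R => z.1 + z.2)); last exact: add_continuous.
  by apply: cvg_pair => /=; [exact: cvg_id|exact: cvg_cst].
move: c; rewrite add0r => /(_ _ Wx) /= W0.
have [I oI IW] := (two_sided_linear (s := R)).2 _ W0.
by exists I => // y /IW /=; rewrite subrK.
Qed.

Lemma nbhs_coset (x : R) (U : set R) : open_subgroup U -> nbhs x (add_coset U x).
Proof.
move=> [oU sU].
have c : (fun y : R => y - x) @ x --> (x - x : R).
  apply: (@continuous_comp _ _ _ (fun y : R => (y, x))
    (fun z : R * R => z.1 - z.2)); last exact: sub_continuous.
  by apply: cvg_pair => /=; [exact: cvg_id|exact: cvg_cst].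
apply: c; apply: open_nbhs_nbhs; split=> //; rewrite subrr; exact: sg0.
Qed.

Lemma separated_eq (x y : R) : (forall I, open_ideal2 I -> I (x - y)) -> x = y.
Proof.
move=> h; pose C (U : set R) := add_coset U x.
have [z [_ zu]] : exists! z : R, forall U, open_subgroup U -> C U = add_coset U z.
  apply: complete_separated; split=> [U oU|U V oU oV VU]; first by exists x.
  by move=> a /VU.
rewrite -(zu x) //; apply: zu => U oU; rewrite /C /add_coset.
have [I oI IU] := open_subgroup_ideal2 oU.
have /IU Uxy := h _ oI; have [_ sU] := oU.
apply/seteqP; split=> a /= Ua; first exact: sg_trans Ua Uxy.
by apply: sg_trans Ua _ => //; exact: sg_sym.
Qed.

Lemma infsum_ex X (r : X -> R) : null_family r -> exists s : R,
  summability.partial_sum r @ summability.totally --> s.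
Proof.
move=> nr.
have /choice[c cP] : forall U : set R, exists A : {fset X},
    open_subgroup U -> forall x, x \notin A -> U (r x).
  move=> U; case: (pselect (open_subgroup U)) => [oU|]; last by exists fset0.
  by have [A hA] := null_familyP nr oU; exists A.
pose p U := \sum_(x <- c U) r x.
have [s [sP _]] :
    exists! s : R, forall U, open_subgroup U -> add_coset U (p U) = add_coset U s.
  apply: complete_separated; split=> [U _|U V oU oV VU]; first by exists (p U).
  move=> a /= /VU Ua; have [_ sU] := oU; apply: (sg_trans sU Ua).
  apply: (@sg_trans _ _ sU (\sum_(x <- (c U `|` c V)%fset) r x)).
    apply: sg_sym => //; apply: sg_subset_sum => //; first exact: fsubsetUr.
    by move=> x xV; apply: VU; exact: cP xV.
  apply: sg_subset_sum => //; first exact: fsubsetUl.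
  by move=> x; exact: cP.
exists s => W /nbhs_ideal[I oI IW]; exists (c I) => //= A cA; apply: IW.
have oI' := open_ideal2_subgroup oI; have [_ sI] := oI'.
rewrite -sP // /add_coset /= partial_sumE.
by apply: sg_subset_sum => // x; exact: cP.
Qed.

Lemma infsum_cvg X (r : X -> R) : null_family r ->
  summability.partial_sum r @ summability.totally --> infsum r.
Proof. by move=> /infsum_ex; exact: xgetPex. Qed.

Lemma infsum_mod X (r : X -> R) (U : set R) (A : {fset X}) : null_family r ->
  open_subgroup U -> (forall x, x \notin A -> U (r x)) ->
  U (infsum r - \sum_(x <- A) r x).
Proof.
move=> nr oU hA; have [_ sU] := oU.
have [B _ /(_ (A `|` B)%fset) /=] := infsum_cvg nr (nbhs_coset (infsum r) oU).
rewrite fsubsetUr /add_coset /= partial_sumE => /(_ isT) h.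
apply: sg_trans (sg_sym sU h) _ => //.
by apply: sg_subset_sum => //; exact: fsubsetUl.
Qed.

Lemma infsum_in X (r : X -> R) (U : set R) : null_family r ->
  open_subgroup U -> (forall x, U (r x)) -> U (infsum r).
Proof.
move=> nr oU h; have := @infsum_mod _ r U fset0 nr oU (fun x _ => h x).
by rewrite big_nil subr0.
Qed.

Lemma null_family_le X (r r' : X -> R) : null_family r ->
  (forall I, open_ideal2 I -> forall x, I (r x) -> I (r' x)) -> null_family r'.
Proof.
move=> nr h; apply: null_family_ideal => I oI.
apply: sub_finite_set (nr I (open_ideal2_subgroup oI)) => x /= n /(h _ oI).
exact: n.
Qed.

Lemma null_family0 X : null_family (fun _ : X => 0 : R).
Proof.
move=> U [_ sU]; rewrite (_ : [set _ | _] = set0) //.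
by rewrite -subset0 => x /=; apply; exact: sg0.
Qed.

Lemma null_familyD X (r r' : X -> R) : null_family r -> null_family r' ->
  null_family (fun x => r x + r' x).
Proof.
move=> nr nr' U oU; have [_ sU] := oU.
have : finite_set ([set x | ~ U (r x)] `|` [set x | ~ U (r' x)]).
  by rewrite finite_setU; split; [exact: nr|exact: nr'].
apply: sub_finite_set => x /= n; case: (pselect (U (r x))) => [Ur|]; last by left.
by right => Ur'; apply: n; exact: sgD.
Qed.

Lemma null_familyZ X a (r : X -> R) : null_family r ->
  null_family (fun x => a * r x).
Proof.
by move=> nr; apply: null_family_le nr _ => I [_ [_ h]] x /(h a)[].
Qed.

Lemma null_familyM X (r c : X -> R) : null_family r ->
  null_family (fun x => r x * c x).
Proof.
by move=> nr; apply: null_family_le nr _ => I [_ [_ h]] x /(h (c x))[].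
Qed.

Lemma null_family_if X (b : X -> bool) (r : X -> R) : null_family r ->
  null_family (fun x => if b x then r x else 0).
Proof.
move=> nr; apply: null_family_le nr _ => I [_ [[? _] _]] x; by case: ifP.
Qed.

Lemma null_family_single X (a : X) (r : X -> R) :
  (forall x, x != a -> r x = 0) -> null_family r.
Proof.
move=> h U [_ sU]; apply: sub_finite_set (finite_set1 a) => x /= n.
by apply/eqP; apply: contra_notT n => /h ->; exact: sg0.
Qed.

Lemma infsum_single X (a : X) (r : X -> R) :
  (forall x, x != a -> r x = 0) -> infsum r = r a.
Proof.
move=> h; apply: separated_eq => I oI; have oI' := open_ideal2_subgroup oI.
have := @infsum_mod _ r I [fset a]%fset (null_family_single h) oI'.
rewrite big_seq_fset1; apply=> x; rewrite in_fset1 => /h ->.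
by have [_ sI] := oI'; exact: sg0.
Qed.

Lemma infsumD X (r r' : X -> R) : null_family r -> null_family r' ->
  infsum (fun x => r x + r' x) = infsum r + infsum r'.
Proof.
move=> nr nr'; apply: separated_eq => I oI; have oI' := open_ideal2_subgroup oI.
have [_ sI] := oI'.
have [A hA] := null_familyP nr oI'; have [B hB] := null_familyP nr' oI'.
have hA' x : x \notin (A `|` B)%fset -> I (r x).
  by rewrite inE negb_or => /andP[/hA].
have hB' x : x \notin (A `|` B)%fset -> I (r' x).
  by rewrite inE negb_or => /andP[_ /hB].
have h x (xAB : x \notin (A `|` B)%fset) : I (r x + r' x).
  by apply: sgD; [exact: sI|exact: hA'|exact: hB'].
apply: (sg_trans sI (infsum_mod (null_familyD nr nr') oI' h)).
apply: sg_sym => //; rewrite big_split /= opprD addrACA; apply: sgD => //.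
  exact: infsum_mod.
exact: infsum_mod.
Qed.

Lemma infsumZ X a (r : X -> R) : null_family r ->
  infsum (fun x => a * r x) = a * infsum r.
Proof.
move=> nr; apply: separated_eq => I oI; have oI' := open_ideal2_subgroup oI.
have [_ sI] := oI'; have [_ [_ hI]] := oI.
have [A hA] := null_familyP nr oI'.
have h x : x \notin A -> I (a * r x) by move=> /hA /(hI a)[].
apply: (sg_trans sI (infsum_mod (null_familyZ a nr) oI' h)).
rewrite -big_distrr -mulrBr; apply: (hI a _ _).1; apply: sg_sym => //.
exact: infsum_mod.
Qed.

Definition fiber_sum X Y (g : X -> Y) (r : X -> R) (y : Y) : R :=
  infsum (fun x => if g x == y then r x else 0).

Lemma fiber_sum_in X Y (g : X -> Y) (r : X -> R) (U : set R) (A : {fset X}) :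
  null_family r -> open_subgroup U -> (forall x, x \notin A -> U (r x)) ->
  forall y, y \notin [fset g x | x in A]%fset -> U (fiber_sum g r y).
Proof.
move=> nr oU hA y yA; have [_ sU] := oU.
apply: infsum_in => //; first exact: null_family_if.
move=> x; case: eqP => [gxy|_]; last exact: sg0.
by apply: hA; apply: contra yA => xA; rewrite -gxy; exact: in_imfset.
Qed.

Lemma null_family_fiber_sum X Y (g : X -> Y) (r : X -> R) : null_family r ->
  null_family (fiber_sum g r).
Proof.
move=> nr U oU; have [A hA] := null_familyP nr oU.
apply: sub_finite_set (finite_fset [fset g x | x in A]%fset) => y /= n.
by apply: contra_notT n; exact: fiber_sum_in.
Qed.

Lemma infsum_fiber X Y (g : X -> Y) (r : X -> R) (c : Y -> R) :
  null_family r ->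
  infsum (fun y => fiber_sum g r y * c y) = infsum (fun x => r x * c (g x)).
Proof.
move=> nr; apply: separated_eq => I oI; have oI' := open_ideal2_subgroup oI.
have [_ sI] := oI'; have [_ [_ hI]] := oI.
have [A hA] := null_familyP nr oI'.
pose B := [fset g x | x in A]%fset.
have hB y : y \notin B -> I (fiber_sum g r y * c y).
  by move=> /(fiber_sum_in nr oI' hA) /(hI (c y))[].
have hA' x : x \notin A -> I (r x * c (g x)) by move=> /hA /(hI (c (g x)))[].
apply: (sg_trans sI (infsum_mod
  (null_familyM c (null_family_fiber_sum g nr)) oI' hB)).
apply: sg_sym => //.
apply: (sg_trans sI (infsum_mod (null_familyM (c \o g) nr) oI' hA')).
have -> : \sum_(x <- A) r x * (c \o g) x =
    \sum_(y <- B) (\sum_(x <- A) if g x == y then r x else 0) * c y.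
  transitivity (\sum_(x <- A) \sum_(y <- B) (if g x == y then r x else 0) * c y).
    rewrite big_seq [RHS]big_seq; apply: eq_bigr => x xA.
    rewrite (bigD1_seq (g x)) ?in_imfset ?fset_uniq //= eqxx big1 ?addr0 //.
    by move=> y /negbTE; rewrite eq_sym => ->; rewrite mul0r.
  by rewrite exchange_big /=; apply: eq_bigr => y _; rewrite big_distrl.
apply: sg_sumB => // y _; rewrite -mulrBl; apply: (hI (c y) _ _).2.
apply: sg_sym => //; apply: infsum_mod => //; first exact: null_family_if.
by move=> x /hA; case: ifP => // _ _; exact: sg0.
Qed.

End NullFamily.

Section LinComb.
Variable R : clinearRingType.
Implicit Types X Y Z : choiceType.

(* lincomb X is R[[X]]; lc_map g, lc_unit and lc_mul are R[[g]] and the unit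
   and multiplication of the monad R[[-]]. *)
Record lincomb (X : choiceType) := LinComb {
  coef : X -> R;
  coefP : null_family coef
}.

Lemma lincomb_eq X (u v : lincomb X) : (forall x, coef u x = coef v x) -> u = v.
Proof.
case: u v => [u nu] [v nv] /= /funext e; subst.
by congr LinComb; exact: Prop_irrelevance.
Qed.

HB.instance Definition _ X := gen_eqMixin (lincomb X).
HB.instance Definition _ X := gen_choiceMixin (lincomb X).

Section Module.
Variable X : choiceType.
Implicit Types u v w : lincomb X.

Definition lc_zero : lincomb X := LinComb (@null_family0 R X).
Definition lc_add u v : lincomb X := LinComb (null_familyD (coefP u) (coefP v)).
Definition lc_scale (a : R) u : lincomb X := LinComb (null_familyZ a (coefP u)).
Definition lc_opp u : lincomb X := lc_scale (-1) u.

Lemma lc_addA : associative lc_add.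
Proof. by move=> u v w; apply: lincomb_eq => x /=; rewrite addrA. Qed.
Lemma lc_addC : commutative lc_add.
Proof. by move=> u v; apply: lincomb_eq => x /=; rewrite addrC. Qed.
Lemma lc_add0 : left_id lc_zero lc_add.
Proof. by move=> u; apply: lincomb_eq => x /=; rewrite add0r. Qed.
Lemma lc_addN : left_inverse lc_zero lc_opp lc_add.
Proof. by move=> u; apply: lincomb_eq => x /=; rewrite mulN1r addNr. Qed.
HB.instance Definition _ :=
  GRing.isZmodule.Build (lincomb X) lc_addA lc_addC lc_add0 lc_addN.

Lemma lc_scaleA a b u : lc_scale a (lc_scale b u) = lc_scale (a * b) u.
Proof. by apply: lincomb_eq => x /=; rewrite mulrA. Qed.
Lemma lc_scale1 : left_id 1 lc_scale.
Proof. by move=> u; apply: lincomb_eq => x /=; rewrite mul1r. Qed.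
Lemma lc_scaleDr : right_distributive lc_scale +%R.
Proof. by move=> a u v; apply: lincomb_eq => x /=; rewrite mulrDr. Qed.
Lemma lc_scaleDl u : {morph lc_scale^~ u : a b / a + b}.
Proof. by move=> a b; apply: lincomb_eq => x /=; rewrite mulrDl. Qed.
HB.instance Definition _ := GRing.Zmodule_isLmodule.Build R (lincomb X)
  lc_scaleA lc_scale1 lc_scaleDr lc_scaleDl.

Lemma coefD u v x : coef (u + v) x = coef u x + coef v x. Proof. by []. Qed.
Lemma coefZ a u x : coef (a *: u) x = a * coef u x. Proof. by []. Qed.
End Module.

Definition lc_unit_coef X (x y : X) : R := if y == x then 1 else 0.
Lemma lc_unit_null X (x : X) : null_family (lc_unit_coef x).
Proof.
by apply: (@null_family_single _ _ x) => y; rewrite /lc_unit_coef => /negbTE ->.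
Qed.
Definition lc_unit X (x : X) : lincomb X := LinComb (lc_unit_null x).

Definition lc_map X Y (g : X -> Y) (u : lincomb X) : lincomb Y :=
  LinComb (null_family_fiber_sum g (coefP u)).

Definition lc_mul_coef X (r : lincomb (lincomb X)) (x : X) : R :=
  infsum (fun u => coef r u * coef u x).
Lemma lc_mul_null X (r : lincomb (lincomb X)) : null_family (lc_mul_coef r).
Proof.
apply: null_family_ideal => I oI; have oI' := open_ideal2_subgroup oI.
have [_ sI] := oI'; have [_ [_ hI]] := oI.
have [A hA] := null_familyP (coefP r) oI'.
have /choice[B hB] : forall u : lincomb X, exists B : {fset X},
    forall x, x \notin B -> I (coef u x).
  by move=> u; exact: null_familyP (coefP u) oI'.
apply: (@sub_finite_set _ _ (\bigcup_(u in [set` A]) [set` B u])); last first.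
  by apply: bigcup_finite => [|u _]; exact: finite_fset.
move=> x /= n; apply: contra_notP n => n.
apply: infsum_in => // [|u]; first exact: null_familyM (coefP r).
case: (boolP (u \in A)) => [uA|/hA /(hI (coef u x))[] //].
have /hB/(hI (coef r u))[] // : x \notin B u.
by apply/negP => xB; apply: n; exists u.
Qed.
Definition lc_mul X (r : lincomb (lincomb X)) : lincomb X :=
  LinComb (lc_mul_null r).

Lemma lc_map_id X (u : lincomb X) : lc_map id u = u.
Proof.
apply: lincomb_eq => x /=; rewrite /fiber_sum (@infsum_single _ _ x) ?eqxx //.
by move=> y /negbTE ->.
Qed.

Lemma lc_map_comp X Y Z (h : Y -> Z) (g : X -> Y) (u : lincomb X) :
  lc_map (fun x => h (g x)) u = lc_map h (lc_map g u).
Proof.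
apply: lincomb_eq => z /=; rewrite {1}/fiber_sum.
have e (W : choiceType) (b : W -> bool) (c : W -> R) :
    (fun x => if b x then c x else 0) = (fun x => c x * (if b x then 1 else 0)).
  by apply/funext => x; case: ifP; rewrite ?mulr1 ?mulr0.
rewrite [RHS]/fiber_sum !e.
by rewrite (infsum_fiber g (fun y => if h y == z then 1 else 0) (coefP u)).
Qed.

Lemma lc_mapD X Y (g : X -> Y) u v : lc_map g (u + v) = lc_map g u + lc_map g v.
Proof.
apply: lincomb_eq => y; rewrite coefD /= /fiber_sum -infsumD;
  [|exact: null_family_if (coefP u)|exact: null_family_if (coefP v)].
by congr infsum; apply/funext => x; case: ifP; rewrite ?addr0.
Qed.

Lemma lc_mapZ X Y (g : X -> Y) a u : lc_map g (a *: u) = a *: lc_map g u.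
Proof.
apply: lincomb_eq => y; rewrite coefZ /= /fiber_sum -infsumZ;
  last exact: null_family_if (coefP u).
by congr infsum; apply/funext => x; case: ifP; rewrite ?mulr0.
Qed.

Lemma lc_map_unit X Y (g : X -> Y) x : lc_map g (lc_unit x) = lc_unit (g x).
Proof.
apply: lincomb_eq => y /=; rewrite /fiber_sum (@infsum_single _ _ x) /=.
  by rewrite /lc_unit_coef eqxx eq_sym.
by move=> z; rewrite /lc_unit_coef => /negbTE ->; case: ifP.
Qed.

Lemma lc_mulD X (r s : lincomb (lincomb X)) :
  lc_mul (r + s) = lc_mul r + lc_mul s.
Proof.
apply: lincomb_eq => x; rewrite coefD /= /lc_mul_coef -infsumD;
  [|exact: null_familyM (coefP r)|exact: null_familyM (coefP s)].
by congr infsum; apply/funext => u; rewrite mulrDl.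
Qed.

Lemma lc_mulZ X a (r : lincomb (lincomb X)) : lc_mul (a *: r) = a *: lc_mul r.
Proof.
apply: lincomb_eq => x; rewrite coefZ /= /lc_mul_coef -infsumZ;
  last exact: null_familyM (coefP r).
by congr infsum; apply/funext => u; rewrite mulrA.
Qed.

Lemma lc_mul_unit X (u : lincomb X) : lc_mul (lc_unit u) = u.
Proof.
apply: lincomb_eq => x /=; rewrite /lc_mul_coef (@infsum_single _ _ u) /=.
  by rewrite /lc_unit_coef eqxx mul1r.
by move=> v; rewrite /lc_unit_coef => /negbTE ->; rewrite mul0r.
Qed.

End LinComb.

Section LinCombChange.
Variables (R S : clinearRingType) (f : {rmorphism R -> S}) (fc : continuous f).
Implicit Types X Y : choiceType.

Lemma preimage_open_subgroup (U : set S) :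
  open_subgroup U -> open_subgroup (f @^-1` U).
Proof.
move=> [oU sU]; split; first by move/continuousP: fc; apply.
split=> [|x y /= Ux Uy]; first by rewrite /= rmorph0; exact: sg0.
by rewrite rmorphB; exact: sgB.
Qed.

Lemma null_family_rmorph (X : choiceType) (r : X -> R) : null_family r ->
  null_family (fun x => f (r x)).
Proof. by move=> nr U /preimage_open_subgroup; exact: nr. Qed.

Lemma infsum_rmorph (X : choiceType) (r : X -> R) : null_family r ->
  f (infsum r) = infsum (fun x => f (r x)).
Proof.
move=> nr; apply: separated_eq => I /open_ideal2_subgroup oI.
have [_ sI] := oI; have [A hA] := null_familyP nr (preimage_open_subgroup oI).
have := infsum_mod nr (preimage_open_subgroup oI) hA.
rewrite /= rmorphB rmorph_sum /= => h; apply: (sg_trans sI h).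
by apply: sg_sym => //; apply: infsum_mod => //; exact: null_family_rmorph.
Qed.

Definition lc_change (X : choiceType) (u : lincomb R X) : lincomb S X :=
  LinComb (null_family_rmorph (coefP u)).

Lemma lc_change_unit X (x : X) : lc_change (lc_unit R x) = lc_unit S x.
Proof.
apply: lincomb_eq => y /=; rewrite /lc_unit_coef.
by case: ifP; rewrite ?rmorph1 ?rmorph0.
Qed.

Lemma lc_change_map X Y (g : X -> Y) (u : lincomb R X) :
  lc_change (lc_map g u) = lc_map g (lc_change u).
Proof.
apply: lincomb_eq => y /=; rewrite /fiber_sum infsum_rmorph;
  last exact: null_family_if (coefP u).
by congr infsum; apply/funext => x; case: ifP; rewrite ?rmorph0.
Qed.

Lemma lc_change_mul X (r : lincomb R (lincomb R X)) :
  lc_change (lc_mul r) = lc_mul (lc_map (@lc_change X) (lc_change r)).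
Proof.
apply: lincomb_eq => x /=; rewrite /lc_mul_coef infsum_rmorph;
  last exact: null_familyM (coefP r).
rewrite (infsum_fiber (@lc_change X) (fun v => coef v x)
  (coefP (lc_change r))) /=.
by congr infsum; apply/funext => u; rewrite rmorphM.
Qed.

Lemma lc_changeD X (u v : lincomb R X) :
  lc_change (u + v) = lc_change u + lc_change v.
Proof. by apply: lincomb_eq => x /=; rewrite rmorphD. Qed.

Lemma lc_changeZ X a (u : lincomb R X) :
  lc_change (a *: u) = f a *: lc_change u.
Proof. by apply: lincomb_eq => x /=; rewrite rmorphM. Qed.

End LinCombChange.

(* Sets are choiceTypes; classically this is no restriction. *)
Record contramodule (R : clinearRingType) := Contramodule {
  contra_set :> choiceType;
  contra_pi : lincomb R contra_set -> contra_set;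
  contra_unit : forall p, contra_pi (lc_unit R p) = p;
  contra_assoc : forall r : lincomb R (lincomb R contra_set),
    contra_pi (lc_map contra_pi r) = contra_pi (lc_mul r)
}.
Arguments contra_pi {R} c.

Section ContraCategory.
Variable R : clinearRingType.
Implicit Types P Q : contramodule R.

Record contra_hom P Q := ContraHom {
  contra_fun :> P -> Q;
  contra_funP : forall u : lincomb R P,
    contra_fun (contra_pi P u) = contra_pi Q (lc_map contra_fun u)
}.

Lemma contra_hom_eq P Q (f g : contra_hom P Q) : (forall p, f p = g p) -> f = g.
Proof.
case: f g => [f fP] [g gP] /= /funext e; subst.
by congr ContraHom; exact: Prop_irrelevance.
Qed.

Program Definition contra_id P : contra_hom P P := @ContraHom P P id _.
Next Obligation. by move=> P u; rewrite lc_map_id. Qed.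

Program Definition contra_comp P Q T (g : contra_hom Q T) (f : contra_hom P Q) :
    contra_hom P T :=
  @ContraHom P T (fun p => g (f p)) _.
Next Obligation. by move=> P Q T g f u /=; rewrite !contra_funP -lc_map_comp. Qed.

Program Definition Contra : category :=
  @Category (contramodule R) contra_hom contra_id contra_comp _ _ _.
Next Obligation. by move=> *; exact: contra_hom_eq. Qed.
Next Obligation. by move=> *; exact: contra_hom_eq. Qed.
Next Obligation. by move=> *; exact: contra_hom_eq. Qed.

(* The module operations of contra_mod P are contra_pi applied to finite formal
   linear combinations. *)
Definition contra_mod P : Type := contra_set P.
HB.instance Definition _ P := Choice.on (contra_mod P).

Section Underlying.
Variable P : contramodule R.
Local Notation M := (contra_mod P).
Local Notation pi := (contra_pi P).
Local Notation e := (@lc_unit R P).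

Definition cm_zero : M := pi 0.
Definition cm_add (p q : M) : M := pi (e p + e q).
Definition cm_scale (a : R) (p : M) : M := pi (a *: e p).
Definition cm_opp (p : M) : M := cm_scale (-1) p.

Lemma contra_piD u v : pi (u + v) = cm_add (pi u) (pi v).
Proof.
rewrite /cm_add -!lc_map_unit -lc_mapD contra_assoc.
by rewrite lc_mulD !lc_mul_unit.
Qed.

Lemma contra_piZ a u : pi (a *: u) = cm_scale a (pi u).
Proof.
by rewrite /cm_scale -lc_map_unit -lc_mapZ contra_assoc lc_mulZ lc_mul_unit.
Qed.

Let piW (K : M -> Prop) : (forall u, K (pi u)) -> forall p, K p.
Proof. by move=> h p; rewrite -(contra_unit p). Qed.

Lemma cm_addA : associative cm_add.
Proof.
by elim/piW=> u; elim/piW=> v; elim/piW=> w; rewrite -!contra_piD addrA.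
Qed.
Lemma cm_addC : commutative cm_add.
Proof. by elim/piW=> u; elim/piW=> v; rewrite -!contra_piD addrC. Qed.
Lemma cm_add0 : left_id cm_zero cm_add.
Proof. by elim/piW=> u; rewrite -contra_piD add0r. Qed.
Lemma cm_addN : left_inverse cm_zero cm_opp cm_add.
Proof.
by elim/piW=> u; rewrite /cm_opp -contra_piZ -contra_piD scaleN1r addNr.
Qed.
HB.instance Definition _ :=
  GRing.isZmodule.Build M cm_addA cm_addC cm_add0 cm_addN.

Lemma cm_scaleA a b p : cm_scale a (cm_scale b p) = cm_scale (a * b) p.
Proof. by elim/piW: p => u; rewrite -!contra_piZ scalerA. Qed.
Lemma cm_scale1 : left_id 1 cm_scale.
Proof. by elim/piW=> u; rewrite -contra_piZ scale1r. Qed.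
Lemma cm_scaleDr : right_distributive cm_scale +%R.
Proof.
move=> a; elim/piW=> u; elim/piW=> v.
by rewrite -[RHS]/(cm_add _ _) -[_ + _]/(cm_add _ _) -!(contra_piZ, contra_piD) scalerDr.
Qed.
Lemma cm_scaleDl p : {morph cm_scale^~ p : a b / a + b}.
Proof.
elim/piW: p => u a b.
by rewrite -[RHS]/(cm_add _ _) -!contra_piZ -contra_piD scalerDl.
Qed.
HB.instance Definition _ := GRing.Zmodule_isLmodule.Build R M
  cm_scaleA cm_scale1 cm_scaleDr cm_scaleDl.
End Underlying.

Section UnderlyingHom.
Variables (P Q : contramodule R) (f : contra_hom P Q).
Definition contra_mod_fun of contra_hom P Q : contra_mod P -> contra_mod Q :=
  fun p => f p.
Lemma contra_mod_fun_linear : linear (contra_mod_fun f).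
Proof.
move=> a p q; rewrite -[LHS]/(f (cm_add (cm_scale a p) q)).
rewrite -[RHS]/(cm_add (cm_scale a (f p)) (f q)).
rewrite -[in LHS](contra_unit q) -contra_piD contra_funP lc_mapD contra_piD.
by rewrite lc_mapZ contra_piZ !lc_map_unit !contra_unit.
Qed.
HB.instance Definition _ := GRing.isLinear.Build R (contra_mod P)
  (contra_mod Q) *:%R (contra_mod_fun f) contra_mod_fun_linear.
Definition contra_mod_hom : {linear contra_mod P -> contra_mod Q} :=
  contra_mod_fun f.
End UnderlyingHom.

Program Definition forgetful : functor Contra (Mod R) :=
  @Functor Contra (Mod R) (fun P => contra_mod P)
    (fun P Q f => contra_mod_hom f) _ _.
Next Obligation. by move=> *; exact: linear_eq. Qed.
Next Obligation. by move=> *; exact: linear_eq. Qed.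

End ContraCategory.

Section ContraRestriction.
Variables (R S : clinearRingType) (f : {rmorphism R -> S}) (fc : continuous f).

Program Definition contra_restr (Q : contramodule S) : contramodule R :=
  @Contramodule R Q (fun u => contra_pi Q (lc_change fc u)) _ _.
Next Obligation. by move=> Q q /=; rewrite lc_change_unit contra_unit. Qed.
Next Obligation.
move=> Q r /=; rewrite (lc_map_comp (contra_pi Q)) !lc_change_map contra_assoc.
by rewrite lc_change_mul.
Qed.

Program Definition contra_restr_hom (P Q : contramodule S)
    (g : contra_hom P Q) : contra_hom (contra_restr P) (contra_restr Q) :=
  @ContraHom R (contra_restr P) (contra_restr Q) g _.
Next Obligation. by move=> P Q g u /=; rewrite contra_funP lc_change_map. Qed.

Program Definition contra_restr_functor : functor (Contra S) (Contra R) :=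
  @Functor (Contra S) (Contra R) contra_restr contra_restr_hom _ _.
Next Obligation. by move=> *; exact: contra_hom_eq. Qed.
Next Obligation. by move=> *; exact: contra_hom_eq. Qed.

Section Square.
Variable Q : contramodule S.

Definition square_fun :
  contra_mod (contra_restr Q) -> restr_mod f (contra_mod Q) := fun q => q.
Definition square_inv_fun :
  restr_mod f (contra_mod Q) -> contra_mod (contra_restr Q) := fun q => q.

Lemma square_linear : linear square_fun.
Proof.
move=> a p q.
rewrite -[LHS]/(contra_pi Q (lc_change fc (@lc_unit R Q (contra_pi Q (lc_change fc
  (a *: @lc_unit R Q p))) + @lc_unit R Q q))).
rewrite -[RHS]/(cm_add (cm_scale (f a) p) q).
by rewrite lc_changeD !lc_change_unit lc_changeZ lc_change_unit.
Qed.
Lemma square_inv_linear : linear square_inv_fun.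
Proof. by move=> a p q; exact: esym (square_linear a p q). Qed.

HB.instance Definition _ := GRing.isLinear.Build R
  (contra_mod (contra_restr Q)) (restr_mod f (contra_mod Q)) *:%R
  square_fun square_linear.
HB.instance Definition _ := GRing.isLinear.Build R
  (restr_mod f (contra_mod Q)) (contra_mod (contra_restr Q)) *:%R
  square_inv_fun square_inv_linear.

Definition square_hom :
  {linear contra_mod (contra_restr Q) -> restr_mod f (contra_mod Q)} :=
  square_fun.
End Square.

(* The two composites agree on underlying sets, but their module operations are
   only propositionally equal, hence an isomorphism over the identity map. *)
Program Definition forgetful_square :
    nat_iso (comp_functor (forgetful R) contra_restr_functor)
            (comp_functor (restr_functor f) (forgetful S)) :=
  @NatIso _ _ (comp_functor (forgetful R) contra_restr_functor)
    (comp_functor (restr_functor f) (forgetful S)) (fun Q => square_hom Q) _ _.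
Next Obligation. by move=> *; exact: linear_eq. Qed.
Next Obligation.
by move=> Q; exists (@square_inv_fun Q : {linear _ -> _}); split; exact: linear_eq.
Qed.

End ContraRestriction.

(* Main.v *)
(* Choose open ideals I_n forming a base of R whose extensions, the closures J_n
   of f(I_n)S, form a base of S.  Expanding the elements of S as convergent sums
   of the f(r_j) t_j makes every S-linear infinite sum an R-linear one, so what
   matters are the relations.  Let T be R or S.  A formal sum of z_j (t_j x_j)
   with z_j in T, t_j in S that vanishes in S[[X]] is a convergent T-linear
   combination of the sums k x, where k runs over the R-linear relations between
   elements of S.  Modulo J_(n+1) this holds because, T/T_(n+1) being a ring
   epimorphic extension of R/I_(n+1) and S/J_(n+1) being flat over R/I_(n+1),
   the map from T_n/T_(n+1) (x) S/J_(n+1) to S/J_(n+1) is injective; successive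
   approximation does the rest.
   For T = S, an R-contramodule map h from S to an S-contramodule kills the
   relation [t] - t[1], so h(t) = t h(1): f_sharp is fully faithful.
   For T = R, D = Hom(S, Q) is an S-contramodule for every R-contramodule Q.  A
   compatible S-module structure on Q makes Q a retract of D via
   i(q) = (t |-> t q) and evaluation at 1.  These maps are R-linear, hence
   R-contramodule maps, so the idempotent on D is an S-contramodule map and Q
   is an S-contramodule. *)

Require Import Defs.
From HB Require Import structures.
From mathcomp Require Import all_boot all_algebra finmap.
From mathcomp Require Import boolp classical_sets functions cardinality.
From mathcomp Require Import topology.
From mathcomp Require Import monalg.

Set Implicit Arguments.
Unset Strict Implicit.
Unset Printing Implicit Defensive.

Import GRing.Theory.
Import Defs.
Local Open Scope classical_set_scope.
Local Open Scope ring_scope.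

(** * Tensor products by generators and relations *)

Lemma zmod_morphismD (U V : zmodType) (g : U -> V) :
  zmod_morphism g -> {morph g : x y / x + y}.
Proof.
move=> gB x y; pose ga : {additive U -> V} :=
  HB.pack g (GRing.isZmodMorphism.Build _ _ g gB).
exact: (raddfD ga).
Qed.

Lemma zmod_morphism0 (U V : zmodType) (g : U -> V) : zmod_morphism g -> g 0 = 0.
Proof. by move=> gB; rewrite -(subrr 0) gB subrr. Qed.

Lemma zmod_morphism_sum (U V : zmodType) (g : U -> V) (I : Type) (r : seq I) F :
  zmod_morphism g -> g (\sum_(i <- r) F i) = \sum_(i <- r) g (F i).
Proof.
move=> gB; exact: (big_morph g (zmod_morphismD gB) (zmod_morphism0 gB)).
Qed.

Lemma zmod_morphismP (U V : zmodType) (g : U -> V) :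
  {morph g : x y / x + y} -> zmod_morphism g.
Proof.
by move=> gD x y; apply/eqP; rewrite -subr_eq0 opprB addrA -gD subrK subrr.
Qed.

Lemma additive_eq (U V : zmodType) (f g : {additive U -> V}) :
  (forall x, f x = g x) -> f = g.
Proof.
case: f g => [f [[f1]]] [g [[g1]]] /= /funext e.
by move: f1 g1; rewrite e => f1 g1; rewrite (Prop_irrelevance f1 g1).
Qed.

Lemma smallest_subgroup (V : zmodType) (D : set V) :
  is_subgroup (smallest (@is_subgroup V) D).
Proof.
split=> [U [sU _]|x y hx hy U [sU DU]]; first exact: sg0.
by apply: sgB => //; [apply: hx|apply: hy].
Qed.

Section MalgSum.
Variables (N G : zmodType) (X : choiceType) (phi : X -> N -> G).
Hypothesis phiB : forall x, zmod_morphism (phi x).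

(** [{malg N[X]}] serves as the direct sum N^(X) of copies of N indexed by X; this is the map out of
    it with components [phi x]. *)
Definition malg_sum (z : {malg N[X]}) : G := \sum_(x <- msupp z) phi x z@_x.

Lemma malg_sumEw (d : {fset X}) z : (msupp z `<=` d)%fset ->
  malg_sum z = \sum_(x <- d) phi x z@_x.
Proof.
move=> zd; rewrite /malg_sum; apply: big_fset_incl => // x _.
by move=> /mcoeff_outdom ->; exact: zmod_morphism0.
Qed.

Lemma malg_sum_zmod_morphism : zmod_morphism malg_sum.
Proof.
move=> z w; rewrite (malg_sumEw (msuppB_le z w)).
rewrite (malg_sumEw (fsubsetUl _ (msupp w))).
rewrite (malg_sumEw (fsubsetUr (msupp z) _)).
by rewrite -sumrB; apply: eq_bigr => x _; rewrite mcoeffB phiB.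
Qed.

Lemma malg_sumU n x : malg_sum << n *g x >> = phi x n.
Proof.
rewrite (@malg_sumEw [fset x]%fset) ?msuppU_le //.
by rewrite big_seq_fset1 mcoeffUU.
Qed.
End MalgSum.

Lemma malg_zmod_morphism_eq (N G : zmodType) (X : choiceType)
    (h1 h2 : {malg N[X]} -> G) : zmod_morphism h1 -> zmod_morphism h2 ->
  (forall n x, h1 << n *g x >> = h2 << n *g x >>) -> h1 =1 h2.
Proof.
move=> h1B h2B h12 z.
pose a1 : {additive {malg N[X]} -> G} :=
  HB.pack h1 (GRing.isZmodMorphism.Build _ _ h1 h1B).
pose a2 : {additive {malg N[X]} -> G} :=
  HB.pack h2 (GRing.isZmodMorphism.Build _ _ h2 h2B).
rewrite -[h1 z]/(a1 z) -[h2 z]/(a2 z) [z]monalgE !raddf_sum.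
by apply: eq_bigr => x _; exact: h12.
Qed.

Section Tensor.
Variables (A : pzRingType) (N : lmodType A^c) (M : lmodType A).
Variables (X : choiceType) (s : X -> M) (s_surj : forall m, exists x, s x = m).

Let s_surj' m : exists x, s x == m.
Proof. by have [x <-] := s_surj m; exists x. Qed.

Definition malg_eval (k : {malg A[X]}) : M := malg_sum (fun x a => a *: s x) k.
Definition malg_act (n : N) (k : {malg A[X]}) : {malg N[X]} :=
  malg_sum (fun x a => << (a : A^c) *: n *g x >>) k.

Lemma malg_eval_zmod_morphism : zmod_morphism malg_eval.
Proof. by apply: malg_sum_zmod_morphism => x a b; rewrite scalerBl. Qed.

Lemma malg_act_phi n (x : X) :
  zmod_morphism (fun a : A => << (a : A^c) *: n *g x >> : {malg N[X]}).
Proof. by move=> a b; rewrite scalerBl monalgUB. Qed.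

Lemma malg_act_zmod_morphism n : zmod_morphism (malg_act n).
Proof. by apply: malg_sum_zmod_morphism; exact: malg_act_phi. Qed.

Lemma malg_evalU a x : malg_eval << a *g x >> = a *: s x.
Proof. by apply: malg_sumU => y b c; rewrite scalerBl. Qed.

Lemma malg_actU n a x : malg_act n << a *g x >> = << (a : A^c) *: n *g x >>.
Proof. exact: (malg_sumU (malg_act_phi n)). Qed.

Lemma mcoeff_malg_act n k x : (malg_act n k)@_x = (k@_x : A^c) *: n.
Proof.
apply: (malg_zmod_morphism_eq (h1 := fun k => (malg_act n k)@_x)
  (h2 := fun k => (k@_x : A^c) *: n)) => [a b|a b|a y].
- by rewrite malg_act_zmod_morphism mcoeffB.
- by rewrite mcoeffB scalerBl.
- by rewrite malg_actU !mcoeffU; case: eqP => _; rewrite // scale0r.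
Qed.

(** By right exactness, N (x) M is N^(X) modulo the subgroup generated by the n k, where k runs over
    the kernel of [malg_eval] from A^(X) onto M. The generators of M are indexed through a
    surjection [s] so that S can later index generators of its own quotients. *)
Definition tensor_rel : set {malg N[X]} := smallest (@is_subgroup _)
  [set z | exists n k, malg_eval k = 0 /\ z = malg_act n k].

Definition tensor_rel_pred : {pred {malg N[X]}} := fun z => `[< tensor_rel z >].

Lemma tensor_rel_zmod_closed : zmod_closed tensor_rel_pred.
Proof.
have [h0 hB] := smallest_subgroup [set z : {malg N[X]} |
  exists n k, malg_eval k = 0 /\ z = malg_act n k].
split=> [|z w /asboolP hz /asboolP hw]; first exact/asboolP.
by apply/asboolP; exact: hB.
Qed.
HB.instance Definition _ :=
  GRing.isZmodClosed.Build _ tensor_rel_pred tensor_rel_zmod_closed.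

Definition tensor : zmodType := Quotient.quot tensor_rel_pred.
Definition tensor_pi (z : {malg N[X]}) : tensor := \pi_tensor%qT z.

Lemma tensor_piP z w : tensor_pi z = tensor_pi w <-> tensor_rel (z - w).
Proof.
rewrite /tensor_pi; split=> [/eqP|h].
  by rewrite -(Quotient.idealrBE tensor_rel_pred) => /asboolP.
by apply/eqP; rewrite -(Quotient.idealrBE tensor_rel_pred); apply/asboolP.
Qed.

Lemma tensor_piB : zmod_morphism tensor_pi.
Proof.
by move=> z w; exact: (pi_is_zmod_morphism (Quotient.quot tensor_rel_pred)).
Qed.
HB.instance Definition _ := GRing.isZmodMorphism.Build _ _ tensor_pi tensor_piB.

Lemma tensor_piW (K : tensor -> Prop) :
  (forall z, K (tensor_pi z)) -> forall t, K t.
Proof. by move=> h t; rewrite -[t]reprK; exact: h. Qed.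

Definition tensor_sect (m : M) : X := xchoose (s_surj' m).
Definition tensor_in (n : N) (m : M) : tensor :=
  tensor_pi << n *g tensor_sect m >>.

Lemma tensor_sectK m : s (tensor_sect m) = m.
Proof. exact/eqP/(xchooseP (s_surj' m)). Qed.

Lemma tensor_pi_act n k w : malg_eval k = 0 ->
  tensor_pi (malg_act n k + w) = tensor_pi w.
Proof.
move=> k0; apply/tensor_piP; rewrite addrK => U [_ DU].
by apply: DU; exists n, k.
Qed.

(** Two preimages of one element of M differ by an element of the kernel, so the section chosen in
    [tensor_in] is immaterial. *)
Lemma tensor_in_pi n x : tensor_in n (s x) = tensor_pi << n *g x >>.
Proof.
set y := tensor_sect (s x).
rewrite -(@tensor_pi_act n (<< 1 *g y >> - << 1 *g x >>)).
  by rewrite malg_act_zmod_morphism !malg_actU !scale1r subrK.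
by rewrite malg_eval_zmod_morphism !malg_evalU tensor_sectK subrr.
Qed.

(** Additivity in m and the exchange of scalars hold because [m + m'] - [m] - [m'] and a[m] - [a m]
    lie in the kernel of [malg_eval]. *)
Lemma tensor_in_balanced : balanced tensor_in.
Proof.
split=> [n n' m|n m m'|n a m]; rewrite /tensor_in.
- by rewrite monalgUD raddfD.
- rewrite -raddfD -[RHS](@tensor_pi_act n (<< 1 *g tensor_sect (m + m') >>
    - << 1 *g tensor_sect m >> - << 1 *g tensor_sect m' >>)).
    rewrite !malg_act_zmod_morphism !malg_actU !scale1r.
    by rewrite -[_ - _ - _]addrA -opprD subrK.
  by rewrite !malg_eval_zmod_morphism !malg_evalU !tensor_sectK !scale1r
    -addrA -opprD subrr.
- rewrite -[RHS](@tensor_pi_act n (<< a *g tensor_sect m >>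
    - << 1 *g tensor_sect (a *: m) >>)).
    by rewrite !malg_act_zmod_morphism !malg_actU !scale1r subrK.
  by rewrite !malg_eval_zmod_morphism !malg_evalU !tensor_sectK !scale1r subrr.
Qed.

Section Universal.
Variables (G : zmodType) (b : N -> M -> G) (bb : balanced b).

Let bN n n' m : b (n - n') m = b n m - b n' m.
Proof.
have [h _ _] := bb.
exact: (zmod_morphismP (g := fun n => b n m) (fun n n' => h n n' m)).
Qed.

Let b0 n : b n 0 = 0.
Proof.
have [_ hD _] := bb.
exact: (zmod_morphism0 (zmod_morphismP (g := b n) (hD n))).
Qed.

Definition tensor_lift0 (z : {malg N[X]}) : G :=
  malg_sum (fun x n => b n (s x)) z.

Lemma tensor_lift0B : zmod_morphism tensor_lift0.
Proof. by apply: malg_sum_zmod_morphism => x n n'; exact: bN. Qed.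

Lemma tensor_lift0U n x : tensor_lift0 << n *g x >> = b n (s x).
Proof. by apply: malg_sumU => y c d; exact: bN. Qed.

Lemma tensor_lift0_act n k : tensor_lift0 (malg_act n k) = b n (malg_eval k).
Proof.
have bD m m' : b n (m - m') = b n m - b n m'.
  by have [_ hD _] := bb; exact: (zmod_morphismP (g := b n) (hD n)).
apply: (malg_zmod_morphism_eq (h1 := fun k => tensor_lift0 (malg_act n k))
  (h2 := fun k => b n (malg_eval k))) => [a c|a c|a y].
- by rewrite malg_act_zmod_morphism tensor_lift0B.
- by rewrite malg_eval_zmod_morphism bD.
- by rewrite malg_actU tensor_lift0U malg_evalU; case: bb => _ _ ->.
Qed.

Lemma tensor_lift0_rel z : tensor_rel z -> tensor_lift0 z = 0.
Proof.
move=> /(_ [set w | tensor_lift0 w = 0]); apply; split.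
  split=> [|x y /= hx hy]; first by rewrite /= -(subrr 0) tensor_lift0B subrr.
  by rewrite /= tensor_lift0B hx hy subrr.
by move=> _ [n [k [k0 ->]]]; rewrite /= tensor_lift0_act k0 b0.
Qed.

Definition tensor_lift of balanced b : tensor -> G :=
  fun t => tensor_lift0 (repr t).

Lemma tensor_lift_pi z : tensor_lift bb (tensor_pi z) = tensor_lift0 z.
Proof.
apply/eqP; rewrite -subr_eq0 -tensor_lift0B; apply/eqP/tensor_lift0_rel.
by apply/tensor_piP; rewrite /tensor_pi reprK.
Qed.

Lemma tensor_lift_zmod_morphism : zmod_morphism (tensor_lift bb).
Proof.
elim/tensor_piW=> z; elim/tensor_piW=> w.
by rewrite -tensor_piB !tensor_lift_pi tensor_lift0B.
Qed.
HB.instance Definition _ :=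
  GRing.isZmodMorphism.Build _ _ (tensor_lift bb) tensor_lift_zmod_morphism.
End Universal.

Lemma tensor_pi_sum z :
  tensor_pi z = \sum_(x <- msupp z) tensor_in z@_x (s x).
Proof.
rewrite [in LHS](monalgE z) raddf_sum.
by apply: eq_bigr => x _; rewrite tensor_in_pi.
Qed.

Lemma tensor_is_tensor : is_tensor tensor_in.
Proof.
split; first exact: tensor_in_balanced.
move=> G b bb; exists (tensor_lift bb : {additive _ -> _}); split=> [n m|h hP].
  by rewrite /= /tensor_in tensor_lift_pi tensor_lift0U // tensor_sectK.
apply: additive_eq; elim/tensor_piW=> z.
transitivity (tensor_lift0 b z); first exact: (tensor_lift_pi bb).
rewrite tensor_pi_sum raddf_sum.
by apply: eq_bigr => x _; rewrite hP.
Qed.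

(** The form in which flatness is exploited: a tensor that vanishes is accounted for by finitely
    many relations between the generators [s x]. *)
Lemma tensor_sum0 (z : {malg N[X]}) :
  \sum_(x <- msupp z) tensor_in z@_x (s x) = 0 -> tensor_rel z.
Proof.
move=> h; rewrite -[z]subr0; apply/tensor_piP.
by rewrite tensor_pi_sum h raddf0.
Qed.
End Tensor.

(** * Ring epimorphisms and flatness *)

Section EndRing.
Variable V : zmodType.

(** A C-module structure on V is a ring map from C to this ring, and [ring_epi] can only be tested
    against ring maps. *)
Definition endo : Type := {additive V -> V}.
HB.instance Definition _ := gen_eqMixin endo.
HB.instance Definition _ := gen_choiceMixin endo.
Implicit Types a b c : endo.

Definition endo_fun a : V -> V := a.

Lemma endo_eq a b : endo_fun a =1 endo_fun b -> a = b.
Proof. exact: additive_eq. Qed.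

Definition mk_endo (g : V -> V) (gB : zmod_morphism g) : endo :=
  HB.pack_for {additive V -> V} g (GRing.isZmodMorphism.Build _ _ g gB).

Lemma endoB a : zmod_morphism (endo_fun a). Proof. exact: raddfB. Qed.
Lemma endoD a x y : endo_fun a (x + y) = endo_fun a x + endo_fun a y.
Proof. exact: raddfD. Qed.

Fact endo0_subproof : zmod_morphism (fun _ : V => 0 : V).
Proof. by move=> x y; rewrite subrr. Qed.
Fact endo1_subproof : zmod_morphism (fun x : V => x).
Proof. by []. Qed.
Fact endoN_subproof a : zmod_morphism (fun x => - endo_fun a x).
Proof. by move=> x y; rewrite endoB opprD. Qed.
Fact endoD_subproof a b : zmod_morphism (fun x => endo_fun a x + endo_fun b x).
Proof. by move=> x y; rewrite !endoB addrACA opprD. Qed.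
Fact endoM_subproof a b : zmod_morphism (fun x => endo_fun a (endo_fun b x)).
Proof. by move=> x y; rewrite !endoB. Qed.

Definition endo_add a b := mk_endo (endoD_subproof a b).
Definition endo_opp a := mk_endo (endoN_subproof a).
Definition endo_mul a b := mk_endo (endoM_subproof a b).

Fact endo_addA : associative endo_add.
Proof. by move=> a b c; apply: endo_eq => x; exact: addrA. Qed.
Fact endo_addC : commutative endo_add.
Proof. by move=> a b; apply: endo_eq => x; exact: addrC. Qed.
Fact endo_add0 : left_id (mk_endo endo0_subproof) endo_add.
Proof. by move=> a; apply: endo_eq => x; exact: add0r. Qed.
Fact endo_addN : left_inverse (mk_endo endo0_subproof) endo_opp endo_add.
Proof. by move=> a; apply: endo_eq => x; exact: addNr. Qed.
HB.instance Definition _ :=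
  GRing.isZmodule.Build endo endo_addA endo_addC endo_add0 endo_addN.

Fact endo_mulA : associative endo_mul.
Proof. by move=> a b c; apply: endo_eq. Qed.
Fact endo_mul1 : left_id (mk_endo endo1_subproof) endo_mul.
Proof. by move=> a; apply: endo_eq. Qed.
Fact endo_1mul : right_id (mk_endo endo1_subproof) endo_mul.
Proof. by move=> a; apply: endo_eq. Qed.
Fact endo_mulDl : left_distributive endo_mul endo_add.
Proof. by move=> a b c; apply: endo_eq. Qed.
Fact endo_mulDr : right_distributive endo_mul endo_add.
Proof. by move=> a b c; apply: endo_eq => x; exact: endoD. Qed.
HB.instance Definition _ := GRing.Zmodule_isPzRing.Build endo
  endo_mulA endo_mul1 endo_1mul endo_mulDl endo_mulDr.
End EndRing.

Section ActionMorphism.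
Variables (C : pzRingType) (V : zmodType) (s : C -> V -> V).
Hypothesis sP : is_module_action s.

Lemma action_zmod_morphism c : zmod_morphism (s c).
Proof.
by have [_ _ sD _] := sP; apply: zmod_morphismP => x y; exact: sD.
Qed.

Definition action_endo (c : C) : endo V :=
  mk_endo (action_zmod_morphism c).

Fact action_endoB : zmod_morphism action_endo.
Proof.
have [_ _ _ sD] := sP => c d; apply: endo_eq => x.
rewrite -[LHS]/(s (c - d) x) -[RHS]/(s c x - s d x).
by apply/eqP; rewrite -subr_eq0 opprB addrA -(sD x) subrK subrr.
Qed.
Fact action_endoM : monoid_morphism action_endo.
Proof.
have [sA s1 _ _] := sP; split=> [|c d]; apply: endo_eq => x; first exact: s1.
by rewrite -[LHS]/(s (c * d) x) -sA.
Qed.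
HB.instance Definition _ := GRing.isZmodMorphism.Build _ _ _ action_endoB.
HB.instance Definition _ := GRing.isMonoidMorphism.Build _ _ _ action_endoM.
End ActionMorphism.

(* The two actions of C on V * W, the diagonal one and its conjugate by the
   automorphism (v, w) |-> (v, w + g v), agree on A, hence on C. *)
Lemma ring_epi_linear (A C : pzRingType) (h : {rmorphism A -> C})
    (V W : zmodType) (sV : C -> V -> V) (sW : C -> W -> W) (g : V -> W) :
  ring_epi h -> is_module_action sV -> is_module_action sW -> zmod_morphism g ->
  (forall a v, g (sV (h a) v) = sW (h a) (g v)) ->
  forall c v, g (sV c v) = sW c (g v).
Proof.
move=> hepi aV aW gB gA c v.
have [sVA sV1 sVD sVd] := aV; have [sWA sW1 sWD sWd] := aW.
have gD := zmod_morphismD gB.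
pose d c (x : V * W) : V * W := (sV c x.1, sW c x.2).
pose e c (x : V * W) : V * W :=
  (sV c x.1, sW c (x.2 - g x.1) + g (sV c x.1)).
have dP : is_module_action d.
  split=> [a b x|x|a x y|x a b]; rewrite /d /=.
  - by rewrite sVA sWA.
  - by rewrite sV1 sW1 -surjective_pairing.
  - by rewrite sVD sWD.
  - by rewrite sVd sWd.
have eP : is_module_action e.
  split=> [a b x|x|a x y|x a b]; rewrite /e /=.
  - by rewrite addrK sVA sWA.
  - by rewrite sV1 sW1 subrK -surjective_pairing.
  - congr (_, _); first exact: sVD.
    rewrite sVD !gD opprD [_ + _ + (_ - _)]addrACA.
    by rewrite [sW a (_ - _ + _)]sWD addrACA.
  - congr (_, _); first exact: sVd.
    by rewrite sVd sWd gD addrACA.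
have : forall c, action_endo dP c = action_endo eP c.
  apply: hepi => a; apply: endo_eq => -[x y].
  rewrite -[LHS]/(d (h a) (x, y)) -[RHS]/(e (h a) (x, y)) /d /e /=.
  by rewrite gA -sWD subrK.
(* At (v, g v) the argument of [sW c] in [e] is g v - g v = 0, so comparing second components gives
   the claim. *)
move=> /(_ c)/(congr1 (fun a => endo_fun a (v, g v))).
rewrite -[LHS]/(d c (v, g v)) -[RHS]/(e c (v, g v)) /d /e /= subrr.
case=> ->; have := action_zmod_morphism aW c (g v) (g v).
by rewrite !subrr => ->; rewrite add0r.
Qed.

Section Converse.
Variables (A C : pzRingType) (h : {rmorphism A -> C}).

Definition conv_map (a : A^c) : C^c := h a.
Fact conv_map_zmod_morphism : zmod_morphism conv_map.
Proof. by move=> a b; exact: (rmorphB h). Qed.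
Fact conv_map_monoid_morphism : monoid_morphism conv_map.
Proof. by split; [exact: (rmorph1 h)|move=> a b; exact: (rmorphM h)]. Qed.
HB.instance Definition _ :=
  GRing.isZmodMorphism.Build A^c C^c conv_map conv_map_zmod_morphism.
HB.instance Definition _ :=
  GRing.isMonoidMorphism.Build A^c C^c conv_map conv_map_monoid_morphism.

End Converse.

Section FlatIdeal.
Variables (A C : pzRingType) (h : {rmorphism A -> C}).

Definition right_module : lmodType A^c :=
  restr_mod (conv_map h : {rmorphism A^c -> C^c}) (C^c)^o.

Variable K : ideal2 C.
Definition ideal_pred : {pred right_module} :=
  fun c => `[< ideal2_set K (c : C) >].
Fact ideal_pred_submod : submod_closed ideal_pred.
Proof.
split=> [|a c d /asboolP Kc /asboolP Kd]; apply/asboolP; first exact: ideal0.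
apply: (idealD (IR := K)) => //. by exact: idealMr.
Qed.
HB.instance Definition _ :=
  GRing.isSubmodClosed.Build _ _ ideal_pred ideal_pred_submod.
Definition ideal_module : Type := {c : right_module | c \in ideal_pred}.
HB.instance Definition _ := SubChoice.on ideal_module.
HB.instance Definition _ := [SubChoice_isSubLmodule of ideal_module by <:].

Definition ideal_quot_module : lmodType A^c :=

  restr_mod (conv_map (quot_pi K \o h : {rmorphism _ -> _})
    : {rmorphism A^c -> (quot_ring K)^c}) ((quot_ring K)^c)^o.

Definition ideal_incl : {linear ideal_module -> right_module} :=
  (val : ideal_module -> right_module).

Definition ideal_proj_fun : right_module -> ideal_quot_module :=
  fun c => quot_pi K (c : C).
Fact ideal_proj_linear : linear ideal_proj_fun.
Proof.
move=> a c d; transitivity (quot_pi K ((c : C) * h a) + quot_pi K d).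
  exact: (rmorphD (quot_pi K) ((c : C) * h a) d).
by congr (_ + _); exact: (rmorphM (quot_pi K)).
Qed.
HB.instance Definition _ :=
  GRing.isLinear.Build _ _ _ _ ideal_proj_fun ideal_proj_linear.
Definition ideal_proj : {linear right_module -> ideal_quot_module} :=
  ideal_proj_fun.

(** The sequence 0 -> K -> C -> C/K -> 0 of right A-modules is the one to be tensored with a flat
    module. *)
Lemma ideal_short_exact : short_exact ideal_incl ideal_proj.
Proof.
split=> [|w|c]; first exact: val_inj.
- by exists (quot_repr w); exact: (quot_reprK w).
- rewrite -[X in X = _]/(quot_pi K (c : C)) -[RHS](rmorph0 (quot_pi K)).
  rewrite quot_piP subr0; split=> [Kc|[u <-]]; last exact/asboolP/(valP u).
  have ic : (c : right_module) \in ideal_pred by apply/asboolP.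
  by exists (exist _ c ic).
Qed.

End FlatIdeal.

Lemma tensor_additive_eq (A : pzRingType) (N : lmodType A^c) (M : lmodType A)
    (X : choiceType) (s : X -> M) (s_surj : forall m, exists x, s x = m)
    (G : zmodType) (g1 g2 : tensor N s -> G) :
  zmod_morphism g1 -> zmod_morphism g2 ->
  (forall n m, g1 (tensor_in s_surj n m) = g2 (tensor_in s_surj n m)) ->
  g1 =1 g2.
Proof.
move=> h1 h2 e; elim/tensor_piW=> z.
pose a1 : {additive tensor N s -> G} :=
  HB.pack g1 (GRing.isZmodMorphism.Build _ _ g1 h1).
pose a2 : {additive tensor N s -> G} :=
  HB.pack g2 (GRing.isZmodMorphism.Build _ _ g2 h2).
rewrite -[g1 _]/(a1 _) -[g2 _]/(a2 _) (tensor_pi_sum s_surj) !raddf_sum.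
by apply: eq_bigr => x _; exact: e.
Qed.

Lemma balanced_comp (A : pzRingType) (N N' : lmodType A^c) (M : lmodType A)
    (G : zmodType) (b : N' -> M -> G) (i : {linear N -> N'}) :
  balanced b -> balanced (fun n m => b (i n) m).
Proof.
move=> [bD bD' bZ]; split=> [n n' m|n m m'|n a m]; first by rewrite raddfD bD.
- exact: bD'.
- by rewrite linearZ bZ.
Qed.

Section FlatRelations.
Variables (A C : pzRingType) (h : {rmorphism A -> C}) (M : lmodType A).
Variables (c : C -> M -> M) (X : choiceType) (s : X -> M).
Hypothesis s_surj : forall m, exists x, s x = m.
Hypothesis hepi : ring_epi h.
Hypothesis cP : induces_module h c.

Let N := right_module h.
Let T := tensor N s.
Let t : N -> M -> T := tensor_in s_surj.

(** Left multiplication by d commutes with the right A-structure of C, so it descends to C (x) M and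
    turns it into a C-module. *)
Let mul_balanced d : balanced (fun (n : N) m => t (d * (n : C)) m).
Proof.
have [tD tD' tZ] := tensor_in_balanced N s_surj.
split=> [n n' m|n m m'|n a m]; last first.
- rewrite /t -[RHS]tZ; congr (tensor_in _ _ m).
  exact: (mulrA d (n : C) (h a)).
- exact: tD'.
- rewrite /t -[RHS]tD; congr (tensor_in _ _ m).
  exact: (mulrDr d (n : C) (n' : C)).
Qed.

Let sT (d : C) : T -> T := tensor_lift (mul_balanced d).

Let sTB d : zmod_morphism (sT d). Proof. exact: raddfB. Qed.

Let sT_in d n m : sT d (t n m) = t (d * (n : C)) m.
Proof.
apply: etrans (tensor_lift_pi s (mul_balanced d) _) _.
apply: etrans (tensor_lift0U s (mul_balanced d) _ _) _.
by rewrite tensor_sectK.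
Qed.

Let sT_action : is_module_action sT.
Proof.
have [tD _ _] := tensor_in_balanced N s_surj.
split=> [a b|x|a x y|x a b].
- have := @tensor_additive_eq _ N _ _ _ s_surj T
    (fun v => sT a (sT b v)) (sT (a * b)).
  apply=> [x y|x y|n m].
  + by rewrite !sTB.
  + exact: sTB.
  + by rewrite !sT_in mulrA.
- move: x; have := @tensor_additive_eq _ N _ _ _ s_surj T (sT 1) id.
  apply=> [y z|//|n m]; first exact: sTB.
  by rewrite sT_in mul1r.
- exact: zmod_morphismD (sTB a) x y.
- move: x; have := @tensor_additive_eq _ N _ _ _ s_surj T (sT (a + b))
    (fun v => sT a v + sT b v).
  apply=> [y z|y z|n m].
  + exact: sTB.
  + by rewrite !sTB opprD addrACA.
  + by rewrite !sT_in mulrDl -tD.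
Qed.

(* m |-> 1 (x) m is A-linear, hence C-linear. *)
Lemma epi_tensor_in (n : N) m :
  tensor_in s_surj n m = tensor_in s_surj ((1 : C) : N) (c (n : C) m).
Proof.
have [_ tD tZ] := tensor_in_balanced N s_surj.
have [cA cf] := cP.
rewrite -[LHS]/(t n m) -[RHS]/(t ((1 : C) : N) (c (n : C) m)).
rewrite (@ring_epi_linear _ _ h _ _ c sT (t ((1 : C) : N)) hepi cA sT_action).
- by rewrite sT_in mulr1.
- by apply: zmod_morphismP => m1 m2; exact: tD.
- move=> a m'; rewrite cf sT_in -[LHS]tZ; congr (t _ m').
  by rewrite -[LHS]/(1 * h a) mul1r mulr1.
Qed.

(** By [epi_tensor_in] the image of z in C (x) M is 1 (x) 0 = 0, and flatness makes K (x) M -> C (x)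
    M injective; so z already vanishes in K (x) M. *)
Lemma flat_relations (K : ideal2 C) (z : {malg (ideal_module h K)[X]}) :
  flat M -> \sum_(x <- msupp z) c (val z@_x : N) (s x) = 0 -> tensor_rel s z.
Proof.
move=> fM z0; apply: (@tensor_sum0 A (ideal_module h K) M X s s_surj).
pose N1 : lmodType A^c := ideal_module h K; pose N2 := ideal_quot_module h K.
have [_ /(_ _ _ (balanced_comp (ideal_incl h K)
  (tensor_in_balanced N s_surj)))] :=
  tensor_is_tensor N1 s_surj.
case=> iM [iMP _].
have [_ /(_ _ _ (balanced_comp (ideal_proj h K)
  (tensor_in_balanced N2 s_surj)))] :=
  tensor_is_tensor N s_surj.
case=> pM [pMP _].
have [iinj _ _] := fM _ _ _ _ _ (ideal_short_exact h K) _ _ _ _ _ _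
  (tensor_is_tensor N1 s_surj) (tensor_is_tensor N s_surj)
  (tensor_is_tensor N2 s_surj) iM pM iMP pMP.
have [_ tD' _] := tensor_in_balanced N s_surj.
have t1B : zmod_morphism (t ((1 : C) : N)).
  by apply: zmod_morphismP => m1 m2; exact: tD'.
apply: iinj; rewrite raddf0 raddf_sum -[RHS](zmod_morphism0 t1B) -z0.
rewrite (zmod_morphism_sum _ _ t1B); apply: eq_bigr => x _.
rewrite iMP; exact: epi_tensor_in.
Qed.
End FlatRelations.

(** * Formal infinite linear combinations *)

Section Bind.
Variable R : clinearRingType.
Implicit Types I X Y Z : choiceType.

(** The Kleisli extension of the monad, that is, the infinite sum of the r_i u_i in R[[X]]. *)
Definition lc_bind I X (r : lincomb R I) (u : I -> lincomb R X) : lincomb R X :=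
  lc_mul (lc_map u r).

Lemma coef_lc_bind I X (r : lincomb R I) (u : I -> lincomb R X) x :
  coef (lc_bind r u) x = infsum (fun i => coef r i * coef (u i) x).
Proof.
by rewrite /= /lc_mul_coef (infsum_fiber u (fun v => coef v x) (coefP r)).
Qed.

(** Interchange of infinite sums. Modulo an open ideal only finitely many i matter, and for these
    only finitely many x, so both sides reduce to the same finite double sum. *)
Lemma infsum_lc_bind I X (r : lincomb R I) (u : I -> lincomb R X) (c : X -> R) :
  infsum (fun x => coef (lc_bind r u) x * c x) =
  infsum (fun i => coef r i * infsum (fun x => coef (u i) x * c x)).
Proof.
apply: separated_eq => J oJ; have oJ' := open_ideal2_subgroup oJ.
have [_ sJ] := oJ'; have [_ [_ hJ]] := oJ.
have [A hA] := null_familyP (coefP r) oJ'.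
have /choice[B hB] : forall i, exists B : {fset X},
    forall x, x \notin B -> J (coef (u i) x).
  by move=> i; exact: null_familyP (coefP (u i)) oJ'.
(* Outside [D], every [u i] with i in [A] has its coefficient in [J]. *)
pose D := (\bigcup_(i <- A) B i)%fset.
have hD i x : i \in A -> x \notin D -> J (coef (u i) x).
  move=> iA xD; apply: hB; apply: contra xD => xB.
  by apply/bigfcupP; exists i => //; rewrite iA.
have nA x : J (coef (lc_bind r u) x - \sum_(i <- A) coef r i * coef (u i) x).
  rewrite coef_lc_bind; apply: infsum_mod => //.
    exact: null_familyM (coefP r).
  by move=> i /hA /(hJ (coef (u i) x))[].
have nD x : x \notin D -> J (coef (lc_bind r u) x * c x).
  move=> xD; apply: (hJ (c x) _ _).2.
  rewrite -[coef _ x](subrK (\sum_(i <- A) coef r i * coef (u i) x)).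
  apply: (sgD sJ (nA x)); apply: sg_sum => // i iA.
  exact: (hJ (coef r i) _ (hD _ _ iA xD)).1.
apply: (sg_trans sJ (infsum_mod (null_familyM c (coefP (lc_bind r u))) oJ' nD)).
apply: sg_sym => //.
have nA' i : i \notin A -> J (coef r i * infsum (fun x => coef (u i) x * c x)).
  by move=> /hA /(hJ (infsum (fun x => coef (u i) x * c x)))[].
apply: (sg_trans sJ (infsum_mod (null_familyM _ (coefP r)) oJ' nA')).
apply: (@sg_trans _ _ sJ
  (\sum_(i <- A) coef r i * \sum_(x <- D) coef (u i) x * c x)).
  apply: sg_sumB => // i iA; rewrite -mulrBr.
  apply: (hJ (coef r i) _ _).1; apply: infsum_mod => //.
    exact: null_familyM (coefP (u i)).
  by move=> x /(hD _ _ iA) /(hJ (c x))[].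
under eq_bigr do rewrite big_distrr /=.
rewrite exchange_big /=; apply: sg_sumB => // x _.
under eq_bigr do rewrite mulrA.
rewrite -big_distrl -mulrBl /=; apply: (hJ (c x) _ _).2.
exact: (sg_sym sJ (nA x)).
Qed.

Lemma lc_bindA I X Y (r : lincomb R I) (u : I -> lincomb R X)
    (v : X -> lincomb R Y) :
  lc_bind (lc_bind r u) v = lc_bind r (fun i => lc_bind (u i) v).
Proof.
apply: lincomb_eq => y; rewrite !coef_lc_bind.
rewrite (infsum_lc_bind r u (fun x => coef (v x) y)).
by congr infsum; apply/funext => i; rewrite coef_lc_bind.
Qed.

Lemma lc_bind_unit I X (i : I) (u : I -> lincomb R X) :
  lc_bind (lc_unit R i) u = u i.
Proof. by rewrite /lc_bind lc_map_unit lc_mul_unit. Qed.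

Lemma lc_mapE X Y (g : X -> Y) (r : lincomb R X) :
  lc_map g r = lc_bind r (fun x => lc_unit R (g x)).
Proof.
apply: lincomb_eq => y; rewrite coef_lc_bind /= /fiber_sum.
congr infsum; apply/funext => x; rewrite /lc_unit_coef eq_sym.
by case: ifP; rewrite ?mulr1 ?mulr0.
Qed.

Lemma lc_bind_map I X Y (g : I -> X) (r : lincomb R I) (u : X -> lincomb R Y) :
  lc_bind (lc_map g r) u = lc_bind r (fun i => u (g i)).
Proof. by rewrite /lc_bind -lc_map_comp. Qed.

Lemma lc_map_bind I X Y (g : X -> Y) (r : lincomb R I) (u : I -> lincomb R X) :
  lc_map g (lc_bind r u) = lc_bind r (fun i => lc_map g (u i)).
Proof.
rewrite lc_mapE lc_bindA; congr lc_bind; apply/funext => i; exact/esym/lc_mapE.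
Qed.

Lemma lc_bindD I X (r r' : lincomb R I) (u : I -> lincomb R X) :
  lc_bind (r + r') u = lc_bind r u + lc_bind r' u.
Proof. by rewrite /lc_bind lc_mapD lc_mulD. Qed.

Lemma lc_bindZ I X a (r : lincomb R I) (u : I -> lincomb R X) :
  lc_bind (a *: r) u = a *: lc_bind r u.
Proof. by rewrite /lc_bind lc_mapZ lc_mulZ. Qed.

Lemma lc_bindB I X (u : I -> lincomb R X) :
  zmod_morphism (fun r : lincomb R I => lc_bind r u).
Proof. by apply: zmod_morphismP => r r'; exact: lc_bindD. Qed.

Lemma lc_bind0r I X (r : lincomb R I) :
  lc_bind r (fun _ => 0 : lincomb R X) = 0.
Proof.
apply: lincomb_eq => x; rewrite coef_lc_bind -[RHS](mulr0 0).
(* The zero family is written as 0 times a null family, so that [infsumZ] evaluates its sum. *)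
rewrite (_ : (fun _ => _) = (fun i => 0 * (coef r i * 0))); last first.
  by apply/funext => i; rewrite mul0r mulr0.
by rewrite (infsumZ _ (null_familyM (fun=> 0) (coefP r))) mul0r mulr0.
Qed.

Lemma lc_coefB X (u v : lincomb R X) x : coef (u - v) x = coef u x - coef v x.
Proof. by rewrite coefD; congr (_ + _); exact: mulN1r. Qed.

(** For U running over a chain of ideals, these subgroups form the filtration of R[[X]] along which
    approximations are made. *)
Definition lc_in X (U : set R) (u : lincomb R X) : Prop :=
  forall x, U (coef u x).

Lemma lc_in_subgroup X U : is_subgroup U -> is_subgroup (@lc_in X U).
Proof.
move=> sU; split=> [x|u v hu hv x]; first exact: sg0.
by rewrite lc_coefB; exact: sgB.
Qed.

Lemma lc_in_bind I X (U : set R) (r : lincomb R I) (u : I -> lincomb R X) :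
  open_ideal2 U -> lc_in U r -> lc_in U (lc_bind r u).
Proof.
move=> oU rU x; rewrite coef_lc_bind; have [_ [_ hU]] := oU.
apply: infsum_in; [exact: null_familyM (coefP r)|exact: open_ideal2_subgroup|].
by move=> i; exact: (hU (coef (u i) x) _ (rU i)).2.
Qed.

Lemma lc_in_map X Y (U : set R) (g : X -> Y) (r : lincomb R X) :
  open_ideal2 U -> lc_in U r -> lc_in U (lc_map g r).
Proof. by move=> oU rU; rewrite lc_mapE; exact: lc_in_bind. Qed.

Lemma lc_coef_sum X (J : Type) (r : seq J) (F : J -> lincomb R X) x :
  coef (\sum_(j <- r) F j) x = \sum_(j <- r) coef (F j) x.
Proof.
apply: (zmod_morphism_sum (g := fun u : lincomb R X => coef u x)).
by move=> u v; exact: lc_coefB.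
Qed.

Definition lc_pair X (p : R * X) : lincomb R X := p.1 *: lc_unit R p.2.

(* Opens the parentheses in the infinite sum of the a_j (t_j x_j). *)
Definition lc_regroup X (v : lincomb R (R * X)%type) : lincomb R X :=
  lc_bind v (@lc_pair X).

Lemma coef_lc_regroup X (v : lincomb R (R * X)%type) x :
  coef (lc_regroup v) x =
  infsum (fun p => coef v p * (p.1 * (if x == p.2 then 1 else 0))).
Proof. exact: coef_lc_bind. Qed.

End Bind.

Section ContraSum.
Variable R : clinearRingType.
Implicit Types I X : choiceType.

Section Sum.
Variable P : contramodule R.

Definition csum I (r : lincomb R I) (p : I -> P) : contra_mod P :=
  contra_pi P (lc_map p r).

Lemma csum_unit I i (p : I -> P) : csum (lc_unit R i) p = p i.
Proof. by rewrite /csum lc_map_unit contra_unit. Qed.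

Lemma csum_bind I X (r : lincomb R I) (u : I -> lincomb R X) (p : X -> P) :
  csum (lc_bind r u) p = csum r (fun i => csum (u i) p).
Proof.
rewrite /csum lc_map_bind /lc_bind -contra_assoc; congr (contra_pi P _).
exact/esym/(lc_map_comp (contra_pi P)).
Qed.

Lemma csum_map I X (r : lincomb R I) (g : I -> X) (p : X -> P) :
  csum (lc_map g r) p = csum r (fun i => p (g i)).
Proof. by rewrite /csum -lc_map_comp. Qed.

Lemma csumD I (r r' : lincomb R I) (p : I -> P) :
  csum (r + r') p = csum r p + csum r' p.
Proof. by rewrite /csum lc_mapD contra_piD. Qed.

Lemma csumZ I a (r : lincomb R I) (p : I -> P) :
  csum (a *: r) p = a *: csum r p.
Proof. by rewrite /csum lc_mapZ contra_piZ. Qed.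

Lemma csumB I (p : I -> P) : zmod_morphism (fun r : lincomb R I => csum r p).
Proof. by apply: zmod_morphismP => r r'; exact: csumD. Qed.

Lemma csum0l I (p : I -> P) : csum 0 p = 0.
Proof. exact: zmod_morphism0 (csumB p). Qed.

Lemma csum0r I (r : lincomb R I) : csum r (fun _ => 0 : contra_mod P) = 0.
Proof.
(* Each 0 is itself the sum with zero coefficients, and the resulting double sum collapses before it
   is evaluated in P. *)
have -> : (fun _ : I => 0 : contra_mod P) =
    (fun i => csum (0 : lincomb R P) (fun p => p)).
  by apply/funext => i; rewrite csum0l.
by rewrite -csum_bind lc_bind0r csum0l.
Qed.

Lemma contra_piE (u : lincomb R P) : contra_pi P u = csum u (fun p => p).
Proof. by rewrite /csum lc_map_id. Qed.

End Sum.

Lemma contra_hom_csum (P Q : contramodule R) (g : contra_hom P Q) I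
    (r : lincomb R I) (p : I -> P) : g (csum r p) = csum r (fun i => g (p i)).
Proof. by rewrite /csum contra_funP -lc_map_comp. Qed.

Section Regular.

Lemma regular_unit (s : R) : infsum (fun t => coef (lc_unit R s) t * t) = s.
Proof.
rewrite (@infsum_single _ _ s) /= /lc_unit_coef ?eqxx ?mul1r //.
by move=> t /negbTE ->; rewrite mul0r.
Qed.

Let regular_pi (u : lincomb R R) : R := infsum (fun t => coef u t * t).

Lemma regular_assoc (r : lincomb R (lincomb R R)) :
  regular_pi (lc_map regular_pi r) = regular_pi (lc_mul r).
Proof.
rewrite /regular_pi -[r in RHS]lc_map_id (infsum_lc_bind r id).
exact: (infsum_fiber regular_pi id (coefP r)).
Qed.

(** The free contramodule on one generator, carried by R itself. *)
Definition regular_contra : contramodule R :=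
  @Contramodule R R regular_pi regular_unit regular_assoc.

End Regular.
End ContraSum.

Section Change.
Variables (R S : clinearRingType) (f : {rmorphism R -> S}) (fc : continuous f).
Implicit Types I X : choiceType.

Lemma lc_change_bind I X (r : lincomb R I) (u : I -> lincomb R X) :
  lc_change fc (lc_bind r u) =
  lc_bind (lc_change fc r) (fun i => lc_change fc (u i)).
Proof.
by rewrite /lc_bind lc_change_mul lc_change_map -lc_map_comp.
Qed.

Lemma csum_restr (Q : contramodule S) I (r : lincomb R I) (p : I -> Q) :
  csum (P := contra_restr fc Q) r p = csum (lc_change fc r) p.
Proof. by rewrite /csum /= lc_change_map. Qed.

End Change.

(** * Successive approximation *)

Section Approximation.
Variables (A B : zmodType) (FA : nat -> set A) (FB : nat -> set B).
Variables (H : set B) (G : A -> B).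
Hypothesis FBsg : forall n, is_subgroup (FB n).
Hypothesis FBS : forall n, FB n.+1 `<=` FB n.
Hypothesis FBsep : forall b, (forall n, FB n b) -> b = 0.
Hypothesis FAcomplete : forall n (a : nat -> A),
  (forall k, FA (n + k)%N (a k)) ->
  exists s, forall K, FA (n + K)%N (s - \sum_(k <- iota 0 K) a k).
Hypothesis GB : zmod_morphism G.
Hypothesis GF : forall n a, FA n a -> FB n (G a).
Hypothesis Hsg : is_subgroup H.
Hypothesis HG : forall a, H (G a).
Hypothesis step : forall n b, H b -> FB n b ->
  exists2 a, FA n a & FB n.+1 (b - G a).

(** Remainders stay in [H] because [H] contains the image of [G], so [step] applies at every level;
    the corrections have a sum by [FAcomplete], and [FBsep] shows that its image is b. [H] is there
    to reach a kernel rather than all of B. *)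
Lemma successive_approximation n b : H b -> FB n b ->
  exists2 a, FA n a & G a = b.
Proof.
move=> Hb Fb.
(* A total choice of corrections; the value 0 is taken where [step] does not apply. *)
have /choice[st stP] : forall nb : nat * B, exists a,
    H nb.2 -> FB nb.1 nb.2 -> FA nb.1 a /\ FB nb.1.+1 (nb.2 - G a).
  move=> [m c] /=; have [[Hc Fc]|nc] := pselect (H c /\ FB m c).
    by have [a] := step Hc Fc; exists a.
  by exists 0 => Hc Fc; case: nc.
pose fix bs k := if k is k'.+1 then bs k' - G (st ((n + k')%N, bs k')) else b.
have bsP k : H (bs k) /\ FB (n + k)%N (bs k).
  elim: k => [|k [Hk Fk]]; first by rewrite addn0.
  have [_ Fk'] := stP ((n + k)%N, bs k) Hk Fk.
  by rewrite addnS; split=> //=; apply: sgB.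
pose a k := st ((n + k)%N, bs k).
have aP k : FA (n + k)%N (a k).
  by have [Hk Fk] := bsP k; have [] := stP ((n + k)%N, bs k) Hk Fk.
have bsE k : b - G (\sum_(i <- iota 0 k) a i) = bs k.
  elim: k => [|k IHk]; first by rewrite big_nil (zmod_morphism0 GB) subr0.
  rewrite -[in iota _ _]addn1 iotaD big_cat big_seq1 (zmod_morphismD GB).
  by rewrite opprD addrA IHk.
have [s sP] := FAcomplete aP.
(* The empty partial sum, K = 0, shows that s lies in [FA n]. *)
exists s; first by have := sP 0; rewrite big_nil subr0 addn0.
apply/eqP; rewrite -subr_eq0; apply/eqP/FBsep => m.
have FBle k j c : FB (k + j)%N c -> FB k c.
  by elim: j => [|j IHj]; rewrite ?addn0 // addnS => /FBS.
apply: (FBle m n); rewrite addnC.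
apply: (sg_trans (FBsg _) (y := G (\sum_(i <- iota 0 m) a i))).
  by rewrite -GB; exact: GF.
by apply: sg_sym => //; rewrite bsE; have [] := bsP m.
Qed.

End Approximation.

(** * Chains of open ideals and completeness of R[[X]] *)

Section Chains.
Variable R : clinearRingType.

(** Starting at the whole ring makes membership at level 0 vacuous, so approximation from level 0
    yields plain surjectivity. *)
Definition ideal_chain (I : nat -> set R) : Prop :=
  [/\ forall n, open_ideal2 (I n), forall n, I n.+1 `<=` I n,
      forall U, open_subgroup U -> exists n, I n `<=` U & I 0%N = setT].

Variables (I : nat -> set R) (Ich : ideal_chain I).

Lemma chain_open n : open_ideal2 (I n). Proof. by case: Ich. Qed.
Lemma chain_subgroup n : open_subgroup (I n).
Proof. exact/open_ideal2_subgroup/chain_open. Qed.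

Lemma chain_le m n : (m <= n)%N -> I n `<=` I m.
Proof.
move=> /subnKC <-; elim: (n - m)%N => [|k IHk]; first by rewrite addn0.
by rewrite addnS; case: Ich => _ h _ _ => x /h /IHk.
Qed.

Lemma lc_chain_sep (X : choiceType) (u : lincomb R X) :
  (forall n, lc_in (I n) u) -> u = 0.
Proof.
move=> h; apply: lincomb_eq => x; apply: separated_eq => J oJ.
have [_ _ hI _] := Ich; have [n nJ] := hI _ (open_ideal2_subgroup oJ).
by rewrite -[coef 0 x]/(0 : R) subr0; exact/nJ/h.
Qed.

(** The sum is taken coefficientwise. It is a null family because modulo [I m] only the terms with k
    < m contribute, each at finitely many x. *)
Lemma lc_chain_complete (X : choiceType) n (a : nat -> lincomb R X) :
  (forall k, lc_in (I (n + k)%N) (a k)) ->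
  exists s : lincomb R X, forall K,
    lc_in (I (n + K)%N) (s - \sum_(k <- iota 0 K) a k).
Proof.
move=> aI; have [_ _ hI _] := Ich.
have nk x : null_family (fun k => coef (a k) x).
  move=> U /hI[m mU]; apply: sub_finite_set (finite_II m) => k /=.
  apply: contra_notT; rewrite -leqNgt => mk; apply: mU.
  by apply: chain_le (aI k x); exact: leq_trans (leq_addl n k).
have nx : null_family (fun x => infsum (fun k => coef (a k) x)).
  move=> U /hI[m mU].
  apply: (@sub_finite_set _ _
    (\bigcup_(k in `I_m) [set x | ~ I m (coef (a k) x)])); last first.
    apply: bigcup_finite => [|k _]; first exact: finite_II.
    exact: (coefP (a k)) (chain_subgroup m).
  move=> x /= nU; apply: contra_notP nU => nU; apply: mU.
  apply: infsum_in => //; first exact: chain_subgroup.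
  move=> k; case: (ltnP k m) => km.
    by apply: contra_notP nU => nk'; exists k.
  by apply: chain_le (aI k x); exact: leq_trans (leq_addl n k).
exists (LinComb nx) => K x; rewrite lc_coefB lc_coef_sum /=.
rewrite (perm_big [fset k in iota 0 K]%fset) /=; last first.
  apply: uniq_perm; rewrite ?iota_uniq ?fset_uniq // => k.
  by rewrite !inE.
apply: infsum_mod => //; first exact: chain_subgroup.
move=> k; rewrite !inE /= mem_iota /= add0n -leqNgt => Kk.
by apply: chain_le (aI k x); rewrite leq_add2l.
Qed.

End Chains.

(** * Values of formal combinations of ring elements *)

Section Value.
Variable S : clinearRingType.

(** The structure map of [regular_contra S]; after a change of coefficients its kernel consists of
    the R-linear relations between elements of S. *)
Definition lc_val (v : lincomb S S) : S := infsum (fun t => coef v t * t).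

Lemma lc_val_zmod_morphism : zmod_morphism lc_val.
Proof.
apply: zmod_morphismP => u v; rewrite /lc_val -infsumD;
  [|exact: null_familyM (coefP u)|exact: null_familyM (coefP v)].
by congr infsum; apply/funext => t; rewrite coefD mulrDl.
Qed.

Lemma lc_regroup_single (X : choiceType) (v : lincomb S S) (x : X) :
  lc_regroup (lc_map (fun t : S => (t, x)) v) = lc_val v *: lc_unit S x.
Proof.
rewrite /lc_regroup lc_bind_map; apply: lincomb_eq => y.
rewrite coef_lc_bind /= /lc_unit_coef /lc_val; case: ifP => _.
  by rewrite mulr1; congr infsum; apply/funext => t; rewrite mulr1.
rewrite mulr0 -[RHS](@infsum_single _ _ (0 : S) (fun _ : S => 0)) //.
by congr infsum; apply/funext => t; rewrite !mulr0.
Qed.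

Lemma coef_lc_regroup_unit (w : lincomb S (S * unit)%type) :
  coef (lc_regroup w) tt = lc_val (lc_map fst w).
Proof.
rewrite coef_lc_regroup /lc_val (infsum_fiber fst id (coefP w)).
by congr infsum; apply/funext => -[t []]; rewrite eqxx mulr1.
Qed.

End Value.

(** * Chains of ideals of R with open extensions to S *)

Section TautChain.
Variables (R S : clinearRingType) (f : {rmorphism R -> S}).

Lemma right_ideal_smallest (D : set S) :
  is_right_ideal (smallest (@is_right_ideal S) D).
Proof.
split=> [|x a hx U [sU DU]]; last by apply: (sU.2); apply: hx.
split=> [U [sU _]|x y hx hy U [sU DU]]; first exact: sg0 sU.1.
by apply: (sgB sU.1); [apply: hx|apply: hy].
Qed.

Lemma closed_right_ideal_gen_sub (I I' : set R) :
  I `<=` I' -> closed_right_ideal_gen f I `<=` closed_right_ideal_gen f I'.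
Proof.
move=> II'; apply: closure_subset => x hx U [sU DU]; apply: hx.
by split=> // _ [r /II' Ir <-]; apply: DU; exists r.
Qed.

Lemma sub_closed_right_ideal_gen (I : set R) r :
  I r -> closed_right_ideal_gen f I (f r).
Proof. by move=> Ir; apply: subset_closure => U [_]; apply; exists r. Qed.

(** An open subgroup is closed: the coset of x modulo U meets the right ideal generated by f(I),
    which lies in U. *)
Lemma closed_right_ideal_gen_min (I : set R) (U : set S) :
  open_ideal2 U -> f @` I `<=` U -> closed_right_ideal_gen f I `<=` U.
Proof.
move=> oU fU x xU; have oU' := open_ideal2_subgroup oU; have [_ sU] := oU'.
have [y [hy /= Uyx]] := xU _ (nbhs_coset x oU').
have Uy : U y.
  by apply: hy; split=> //; split=> // z a Uz; have [_ [_ /(_ a z Uz)[]]] := oU.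
by rewrite -[x](subKr y); apply: sgB.
Qed.

Lemma closed_right_ideal_genT : closed_right_ideal_gen f setT = setT.
Proof.
apply/seteqP; split=> // s _; apply: subset_closure; rewrite -(mul1r s).
apply: (right_ideal_smallest _).2 => U [_]; apply.
by exists 1; rewrite ?rmorph1.
Qed.

Lemma open_ideal2T (Q : clinearRingType) : open_ideal2 [set: Q].
Proof. by split; [exact: openT|split]. Qed.

(** Tautness allows each term to be shrunk into the previous one and into the next member of a
    countable base of R. The extensions then form a base of S: by continuity some f(I_n) lies in a
    given open ideal, which contains the closure as well. *)
Lemma taut_chain : has_countable_base R -> continuous f ->
  strongly_right_taut f -> exists2 I : nat -> set R,
    ideal_chain I & ideal_chain (fun n => closed_right_ideal_gen f (I n)).
Proof.
move=> [B /countable_injP[h hinj] [Bn Bb]] fc [tn tb].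
(* [V n] is the member of the base numbered n by [h], and the whole ring if there is none. *)
have /choice[V VP] : forall n : nat, exists V : set R,
    nbhs 0 V /\ (forall W, B W -> h W = n -> W = V).
  move=> n; have [[W [BW hW]]|nW] := pselect (exists W, B W /\ h W = n).
    exists W; split; first exact: Bn.
    by move=> W' BW' hW'; apply: hinj; rewrite ?inE // hW hW'.
  exists setT; split; first exact: filterT.
  by move=> W BW hW; case: nW; exists W.
pose taut (I : set R) :=
  open_ideal2 I /\ open_ideal2 (closed_right_ideal_gen f I).
have /choice[nx nxP] : forall nI : nat * set R, exists I, taut nI.2 ->
    [/\ taut I, I `<=` V nI.1 & I `<=` nI.2].
  move=> [n I] /=; have [tI|nt] := pselect (taut I); last by exists setT.
  have [|I' tI' sI'] := tb (V n `&` I).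
    apply: filterI; first by have [] := VP n.
    by apply: open_nbhs_nbhs; case: tI => -[oI [[I0 _] _]] _.
  by exists I' => _; split=> // x /sI'[].
pose fix I n := if n is n'.+1 then nx (n', I n') else setT.
have tI n : taut (I n).
  elim: n => [|n tIn]; last by have [] := nxP (n, I n) tIn.
  rewrite /taut /= closed_right_ideal_genT.
  by split; exact: open_ideal2T.
have Ile n : I n.+1 `<=` I n by have [] := nxP (n, I n) (tI n).
have Ib U : nbhs 0 U -> exists n, I n `<=` U.
  (* The successor appears because the n-th member of the base constrains only the term after
     [I n]. *)
  move=> /Bb[W BW WU]; exists (h W).+1.
  have [_ IV _] := nxP (h W, I (h W)) (tI _).
  have [_ /(_ W BW erefl) WV] := VP (h W).
  by apply: subset_trans IV _; rewrite -WV.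
have nb0 (Q : clinearRingType) (U : set Q) : open_subgroup U -> nbhs 0 U.
  by move=> [oU [U0 _]]; apply: open_nbhs_nbhs.
exists I; split=> [n|n|U oU|].
- by have [] := tI n.
- exact: Ile.
- exact/Ib/nb0.
- by [].
- by have [] := tI n.
- exact: closed_right_ideal_gen_sub.
- have [U' oU' U'U] := open_subgroup_ideal2 oU.
  have /nb0/Ib[n IU'] := preimage_open_subgroup fc (open_ideal2_subgroup oU').
  exists n; apply: subset_trans U'U; apply: closed_right_ideal_gen_min => //.
  by move=> _ [r /IU' fr <-].
- exact: closed_right_ideal_genT.
Qed.

End TautChain.

Section ChangeCoefficients.
Variables (R S : clinearRingType) (f : {rmorphism R -> S}) (fc : continuous f).

Lemma lc_change_zmod_morphism (X : choiceType) :
  zmod_morphism (@lc_change _ _ _ fc X).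
Proof. by apply: zmod_morphismP => u v; exact: lc_changeD. Qed.

Lemma lc_in_change (X : choiceType) (U : set R) (V : set S) (u : lincomb R X) :
  (forall r, U r -> V (f r)) -> lc_in U u -> lc_in V (lc_change fc u).
Proof. by move=> UV uU x; apply: UV; exact: uU. Qed.

End ChangeCoefficients.

(** Summing first along the map to a point makes the right factor a coefficient on that point. *)
Lemma infsumMr (R : clinearRingType) (X : choiceType) (r : X -> R) a :
  null_family r -> infsum (fun x => r x * a) = infsum r * a.
Proof.
move=> nr; rewrite -(infsum_fiber (fun=> tt) (fun=> a) nr).
rewrite (@infsum_single _ _ tt) => [|[]//].
by congr (infsum _ * _); apply/funext => x; rewrite eqxx.
Qed.

Lemma coef_lc_map_pair (R : clinearRingType) (Y X : choiceType)
    (u : lincomb R Y) (x : X) t y :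
  coef (lc_map (fun t : Y => (t, x)) u) (t, y) = if y == x then coef u t else 0.
Proof.
rewrite /= /fiber_sum; under eq_fun do rewrite xpair_eqE [x == y]eq_sym.
case: ifP => _.
  by rewrite (@infsum_single _ _ t) ?eqxx // => z /negbTE ->.
by rewrite (@infsum_single _ _ t) ?andbF // => z; rewrite andbF.
Qed.

(** * Expanding elements of S with coefficients in R *)

Section Onto.
Variables (R S : clinearRingType) (f : {rmorphism R -> S}) (fc : continuous f).
Variable I : nat -> set R.
Let J n := closed_right_ideal_gen f (I n).
Hypotheses (Ich : ideal_chain I) (Jch : ideal_chain J).

(** The values of combinations with coefficients in I_n form a right ideal containing f(I_n): to
    multiply by a on the right, relabel each t as t a. *)
Lemma right_ideal_gen_val n s :
  smallest (@is_right_ideal S) (f @` I n) s ->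
  exists2 v : lincomb R S, lc_in (I n) v & lc_val (lc_change fc v) = s.
Proof.
have oI := chain_open Ich n; have [_ sI] := open_ideal2_subgroup oI.
move=> /(_ [set s | exists2 v : lincomb R S,
  lc_in (I n) v & lc_val (lc_change fc v) = s]); apply; split.
  split=> [|x a [v vI <-]].
    split=> [|x y [v vI <-] [w wI <-]].
      exists 0; first by move=> x; exact: sg0.
      by rewrite (zmod_morphism0 (@lc_change_zmod_morphism _ _ f fc _))
        (zmod_morphism0 (@lc_val_zmod_morphism S)).
    exists (v - w); first exact: (sgB (lc_in_subgroup _ sI)).
    by rewrite lc_change_zmod_morphism lc_val_zmod_morphism.
  exists (lc_map (fun t => t * a) v); first exact: lc_in_map.
  rewrite lc_change_map /lc_val.
  rewrite (infsum_fiber (fun t => t * a) id (coefP (lc_change fc v))).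
  rewrite -infsumMr; last exact: null_familyM (coefP (lc_change fc v)).
  by congr infsum; apply/funext => t; rewrite mulrA.
move=> _ [r Ir <-]; exists (r *: lc_unit R 1).
  move=> t; rewrite coefZ /= /lc_unit_coef; case: ifP => _.
    by rewrite mulr1.
  by rewrite mulr0; exact: sg0.
rewrite lc_changeZ lc_change_unit /lc_val (@infsum_single _ _ (1 : S)).
  by rewrite coefZ /= /lc_unit_coef eqxx !mulr1.
by move=> t; rewrite coefZ /= /lc_unit_coef => /negbTE ->; rewrite mulr0 mul0r.
Qed.

(** Successive approximation. Modulo J_(k+1) only finitely many coefficients of u survive, and each,
    lying in the closure J_k, is congruent to an element of the right ideal generated by f(I_k). *)
Lemma lc_regroup_onto (X : choiceType) n (u : lincomb S X) : lc_in (J n) u ->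
  exists2 v : lincomb R (S * X)%type, lc_in (I n) v &
    lc_regroup (lc_change fc v) = u.
Proof.
pose G (v : lincomb R (S * X)%type) := lc_regroup (lc_change fc v).
have GB : zmod_morphism G.
  by move=> v w; rewrite /G lc_change_zmod_morphism; exact: lc_bindB.
have sI k : is_subgroup (I k) by have [] := chain_subgroup Ich k.
have sJ k : is_subgroup (J k) by have [] := chain_subgroup Jch k.
move=> uJ; apply: (@successive_approximation _ _
  (fun k => @lc_in R (S * X)%type (I k)) (fun k => @lc_in S X (J k))
  setT G) => //.
- by move=> k; exact: lc_in_subgroup.
- by move=> k v vJ x; apply: (chain_le Jch (leqnSn k)).
- exact: lc_chain_sep.
- exact: lc_chain_complete.
- move=> k v vI; apply: lc_in_bind; first exact: chain_open.
  by apply: lc_in_change vI => r; exact: sub_closed_right_ideal_gen.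
move=> k {u uJ} u _ uJ.
have [A hA] := null_familyP (coefP u) (chain_subgroup Jch k.+1).
have /choice[v vP] : forall x, exists v : lincomb R S, lc_in (I k) v /\
    J k.+1 (lc_val (lc_change fc v) - coef u x).
  move=> x; have [s [/right_ideal_gen_val[v vI <-] hs]] :=
    uJ x _ (nbhs_coset (coef u x) (chain_subgroup Jch k.+1)).
  by exists v.
exists (\sum_(x <- A) lc_map (fun t : S => (t, x)) (v x)).
  refine (sg_sum (lc_in_subgroup _ (sI k)) _) => x _.
  apply: lc_in_map; first exact: chain_open.
  by have [] := vP x.
move=> y; rewrite (zmod_morphism_sum _ _ GB) lc_coefB lc_coef_sum.
have -> : \sum_(x <- A) coef (G (lc_map (fun t : S => (t, x)) (v x))) y =
    if y \in A then lc_val (lc_change fc (v y)) else 0.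
  rewrite (eq_bigr (fun x =>
    if y == x then lc_val (lc_change fc (v y)) else 0)).
    case: ifPn => yA; last first.
      rewrite big1_seq // => x /andP[_ xA].
      by case: eqP yA => // ->; rewrite xA.
    rewrite (bigD1_seq y) ?fset_uniq //= eqxx big1 ?addr0 // => x.
    by rewrite eq_sym => /negbTE ->.
  move=> x _; rewrite /G lc_change_map lc_regroup_single coefZ /=.
  by rewrite /lc_unit_coef; case: eqP => [->|_]; rewrite ?mulr1 ?mulr0.
case: ifPn => [_|/hA yA]; last by rewrite subr0.
by apply: (sg_sym (sJ _)); have [] := vP y.
Qed.

(** Approximate relations can be made exact. A value in J_n is also the value of some w with
    coefficients in I_n, by [lc_regroup_onto] over a point, and v - w is the relation sought. *)
Lemma lc_kernel_lift n (v : lincomb R S) : J n (lc_val (lc_change fc v)) ->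
  exists2 k : lincomb R S, lc_val (lc_change fc k) = 0 & lc_in (I n) (v - k).
Proof.
move=> vJ; pose s := lc_val (lc_change fc v).
have sJ : lc_in (J n) (s *: lc_unit S tt).
  by case; rewrite coefZ /= /lc_unit_coef eqxx mulr1.
have [w wI ws] := lc_regroup_onto sJ.
exists (v - lc_map fst w); last first.
  by rewrite subKr; apply: lc_in_map => //; exact: chain_open.
rewrite lc_change_zmod_morphism lc_val_zmod_morphism lc_change_map.
rewrite -coef_lc_regroup_unit ws coefZ /= /lc_unit_coef eqxx mulr1.
by rewrite -/s subrr.
Qed.
End Onto.

(** * Relations between elements of S *)

Section ImageIdeal.
Variables (T : pzRingType) (D : ideal2 T) (E : ideal2 T).

(** For consecutive terms of a chain this is the ideal T_n/T_(n+1) of T/T_(n+1). *)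
Definition quot_image : set (quot_ring E) := quot_pi E @` D.

Lemma quot_image_ideal : is_ideal2 quot_image.
Proof.
split=> [|a _ [x Dx <-]].
  split=> [|_ _ [x Dx <-] [y Dy <-]].
    by exists 0; [exact: ideal0|exact: rmorph0].
  by exists (x - y); [exact: idealB|exact: rmorphB].
rewrite -(quot_reprK a) -!rmorphM.
split; [exists (quot_repr a * x)|exists (x * quot_repr a)] => //.
  exact: idealMl.
exact: idealMr.
Qed.

Definition quot_image_ideal2 := Ideal2 quot_image_ideal.
End ImageIdeal.

(** * Combinations of relations over a ring T between R and S *)

Section Decomposition.
Variables (R T S : clinearRingType).
Variables (f : {rmorphism R -> S}) (fc : continuous f).
Variables (g : {rmorphism R -> T}) (gc : continuous g).
Variables (g' : {rmorphism T -> S}) (g'c : continuous g').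
Hypothesis g'g : forall r, g' (g r) = f r.
Variables (I : nat -> set R) (JT : nat -> set T).
Let J n := closed_right_ideal_gen f (I n).
Hypotheses (Ich : ideal_chain I) (Jch : ideal_chain J) (JTch : ideal_chain JT).
Hypothesis gI : forall n, g @` I n `<=` JT n.
Hypothesis g'JT : forall n, g' @` JT n `<=` J n.

Let IR n : ideal2 R := Ideal2 (chain_open Ich n).2.
Let IT n : ideal2 T := Ideal2 (chain_open JTch n).2.
Let IS n : ideal2 S := Ideal2 (chain_open Jch n).2.

Let gIT n : g @` IR n `<=` IT n. Proof. exact: gI. Qed.
Let g'IS n : g' @` IT n `<=` IS n. Proof. exact: g'JT. Qed.
Let fIS n : f @` IR n `<=` IS n.
Proof. by move=> _ [r Ir <-]; exact: sub_closed_right_ideal_gen. Qed.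

Hypothesis epi : forall n, ring_epi (quot_map (@gIT n)).
Hypothesis flatS : forall n (fIJ : f @` IR n `<=` IS n),
  flat (restr_mod (quot_map fIJ) (quot_ring (IS n))^o).

Variable X : choiceType.

(* The R-linear relations between elements of S. *)
Definition lc_kernel := {k : lincomb R S | lc_val (lc_change fc k) == 0}.
HB.instance Definition _ := Choice.on lc_kernel.

Definition lc_unfold (w : lincomb T (lc_kernel * X)%type) :
    lincomb T (S * X)%type :=
  lc_bind w (fun p => lc_map (fun t : S => (t, p.2)) (lc_change gc (val p.1))).

Let lc_change_comp (Y : choiceType) (u : lincomb R Y) :
  lc_change g'c (lc_change gc u) = lc_change fc u.
Proof. by apply: lincomb_eq => y /=; exact: g'g. Qed.

(** Each k has value zero, so unfolding lands in the kernel of regrouping; [lc_unfold_onto] shows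
    that it fills this kernel. *)
Lemma lc_regroup_unfold w : lc_regroup (lc_change g'c (lc_unfold w)) = 0.
Proof.
rewrite /lc_unfold lc_change_bind /lc_regroup lc_bindA.
rewrite -[RHS](lc_bind0r _ (lc_change g'c w)); congr lc_bind.
apply/funext => -[k x].
rewrite -[LHS]/(lc_regroup _) lc_change_map lc_change_comp lc_regroup_single /=.
by rewrite (eqP (valP k)) scale0r.
Qed.

Let act n : quot_ring (IT n) -> quot_ring (IS n) -> quot_ring (IS n) :=
  fun d m => quot_map (@g'IS n) d * m.

Let M n : lmodType (quot_ring (IR n)) :=
  restr_mod (quot_map (@fIS n)) (quot_ring (IS n))^o.

Let act_induces n : @induces_module _ _ (quot_map (@gIT n)) (M n) (@act n).
Proof.
split=> [|a v]; last first.
  rewrite /act.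
  have -> : quot_map (@g'IS n) (quot_map (@gIT n) a) = quot_map (@fIS n) a.
    by rewrite -(quot_reprK a) !quot_map_pi g'g.
  by [].
split=> [a b v|v|a v w|v a b]; rewrite /act.
- by rewrite rmorphM mulrA.
- by rewrite rmorph1 mul1r.
- exact: mulrDr.
- by rewrite rmorphD; exact: mulrDl.
Qed.

Let sM n : S -> M n := quot_pi (IS n).
Let sM_surj n (m : M n) : exists t, sM n t = m.
Proof. by exists (quot_repr m); exact: quot_reprK. Qed.

Let K n := quot_image_ideal2 (IT n) (IT n.+1).
Let N n := ideal_module (quot_map (@gIT n.+1)) (K n).

(** Holds when u, placed in the coordinate x, is modulo T_(n+1) an unfolding with coefficients in
    T_n. Such u form a subgroup, so for [tensor_rel] only the generators need to be checked. *)
Let lift n (x : X) (u : {malg (N n)[S]}) : Prop :=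
  exists2 w, lc_in (JT n) w & forall t y,
    quot_pi (IT n.+1) (coef (lc_unfold w) (t, y)) =
    if y == x then (val u@_t : right_module (quot_map (@gIT n.+1))) else 0.

Let lc_unfoldB : zmod_morphism lc_unfold.
Proof. exact: lc_bindB. Qed.

Let lift_subgroup n x : is_subgroup (@lift n x).
Proof.
have [_ sJT] := chain_subgroup JTch n.
split=> [|u v [w wJ wu] [w' w'J w'v]].
  exists 0 => [y|t y]; first exact: sg0.
  by rewrite (zmod_morphism0 lc_unfoldB) mcoeff0 if_same; exact: rmorph0.
exists (w - w') => [|t y]; first exact: (sgB (lc_in_subgroup _ sJT)).
rewrite lc_unfoldB lc_coefB mcoeffB.
transitivity (quot_pi (IT n.+1) (coef (lc_unfold w) (t, y))
  - quot_pi (IT n.+1) (coef (lc_unfold w') (t, y))); first exact: rmorphB.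
by rewrite wu w'v; case: ifP => _; rewrite ?subr0.
Qed.

(** The relation k over R/I_(n+1) is lifted coefficientwise to [k1] and then corrected to an exact
    relation [k2] congruent to it modulo I_(n+1); d lifts to some [c] in T_n, and [c] times the pair
    of [k2] and x is the required combination. *)
Let lift_act n x (d : N n) (k : {malg (quot_ring (IR n.+1))[S]}) :
  malg_eval (sM n.+1) k = 0 -> lift x (malg_act d k).
Proof.
move=> k0; have /asboolP[c Jc cd] := valP d.
have [_ sJ] := chain_subgroup Jch n.+1.
(* Off the support the lift must be 0 itself, to give a null family. *)
pose k1 t : R := if t \in msupp k then quot_repr k@_t else 0.
have k1n : null_family k1.
  move=> U [_ sU]; apply: sub_finite_set (finite_fset (msupp k)) => t /=.
  by rewrite /k1; case: ifP => // _ []; exact: sg0.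
have k1k t : quot_pi (IR n.+1) (k1 t) = k@_t.
  rewrite /k1; case: ifPn => [_|/mcoeff_outdom ->]; first exact: quot_reprK.
  exact: rmorph0.
have [] := @lc_kernel_lift _ _ _ fc I Ich Jch n.+1 (LinComb k1n).
  suff : quot_pi (IS n.+1) (lc_val (lc_change fc (LinComb k1n))) = 0.
    by rewrite -(rmorph0 (quot_pi (IS n.+1))) quot_piP subr0.
  rewrite -k0 /malg_eval /malg_sum.
  transitivity (quot_pi (IS n.+1) (\sum_(t <- msupp k) f (k1 t) * t)).
    apply/quot_piP; apply: infsum_mod; first exact: null_familyM (coefP _).
      exact: (chain_subgroup Jch n.+1).
    by move=> t /negbTE tk; rewrite /= /k1 tk rmorph0 mul0r; exact: sg0.
  rewrite rmorph_sum; apply: eq_bigr => t _.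
  rewrite -k1k -[RHS]/(quot_map (@fIS n.+1) _ * quot_pi _ t) quot_map_pi.
  exact: rmorphM.
move=> k2 /eqP k20 k2I; pose k2' : lc_kernel := exist _ k2 k20.
exists (c *: lc_unit T (k2', x)).
  move=> y; rewrite coefZ; have [_ [_ h]] := chain_open JTch n.
  exact: (h (coef (lc_unit T (k2', x)) y) c Jc).2.
move=> t y; rewrite /lc_unfold lc_bindZ lc_bind_unit coefZ coef_lc_map_pair.
case: ifP => _; last by rewrite mulr0; exact: rmorph0.
rewrite mcoeff_malg_act.
transitivity (quot_pi (IT n.+1) c * quot_map (@gIT n.+1) k@_t);
  last by rewrite cd.
rewrite -k1k quot_map_pi; apply: etrans (rmorphM (quot_pi (IT n.+1)) _ _) _.
congr (_ * _); apply/quot_piP.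
rewrite -rmorphB; apply: gI; exists (coef k2 t - k1 t) => //.
have [_ sI] := chain_subgroup Ich n.+1; apply: (sg_sym sI).
by have := k2I t; rewrite lc_coefB.
Qed.

(** Modulo T_(n+1), u is finite and splits by x into elements of (T_n/T_(n+1))^(S) with value zero
    in S/J_(n+1). By [flat_relations] these come from relations, which [lift_act] lifts. *)
Lemma lc_unfold_step n (u : lincomb T (S * X)%type) :
  lc_regroup (lc_change g'c u) = 0 -> lc_in (JT n) u ->
  exists2 w, lc_in (JT n) w & lc_in (JT n.+1) (u - lc_unfold w).
Proof.
move=> u0 uJ; have [A hA] := null_familyP (coefP u) (chain_subgroup JTch n.+1).
pose q := quot_pi (IT n.+1).
have qA p : p \notin A -> q (coef u p) = 0.
  move=> /hA up; apply: etrans (rmorph0 (quot_pi (IT n.+1))).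
  by apply/quot_piP; rewrite subr0.
have nzP p : (q (coef u p) : right_module (quot_map (@gIT n.+1)))
    \in ideal_pred (K n).
  by apply/asboolP; exists (coef u p).
pose nz p : N n := exist _ (q (coef u p)) (nzP p).
pose ux x : {malg (N n)[S]} :=
  \sum_(p <- A) << (if p.2 == x then nz p else 0) *g p.1 >>.
have uxE x t : val (ux x)@_t = q (coef u (t, x)).
  rewrite raddf_sum raddf_sum.
  have h p : p != (t, x) ->
      val << (if p.2 == x then nz p else 0) *g p.1 >>@_t = 0.
    case: p => t' x' /=; rewrite xpair_eqE mcoeffU.
    by case: eqP => [->|_]; case: eqP => [->|_]; rewrite ?mul0rn.
  have [tA|tA] := boolP ((t, x) \in A); last first.
    rewrite qA // big_seq big1 // => p pA; apply: h.
    by apply: contraNneq tA => <-.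
  rewrite (bigD1_seq (t, x)) ?fset_uniq //= eqxx mcoeffUU big1 ?addr0 //.
have hx x : lift x (ux x).
  suff /(_ (@lift n x)) : tensor_rel (sM n.+1) (ux x).
    apply; split; first exact: lift_subgroup.
    by move=> _ [d [k [k0 ->]]]; exact: lift_act.
  apply: (@flat_relations _ _ _ (M n.+1) (@act n.+1) _ _ (@sM_surj n.+1)
    (@epi n.+1) (@act_induces n.+1) (K n)); first exact: flatS.
  have cB t : zmod_morphism (fun d : N n => @act n.+1 (val d) (sM n.+1 t)).
    move=> d e; rewrite /act -mulrBl; congr (_ * _); rewrite -rmorphB.
    by congr quot_map; exact: (raddfB (ideal_incl _ (K n)) d e).
  transitivity (malg_sum (fun t (d : N n) => @act n.+1 (val d) (sM n.+1 t))
    (ux x)).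
    by [].
  rewrite (zmod_morphism_sum _ _ (malg_sum_zmod_morphism cB)).
  rewrite (eq_bigr _ (fun p _ => malg_sumU cB _ _)).
  (* The value of [ux x] is the coefficient at x of the regrouped u, which is zero, up to the terms
     outside [A], which lie in J_(n+1). *)
  transitivity (quot_pi (IS n.+1)
      (\sum_(p <- A) g' (coef u p) * (p.1 * (if x == p.2 then 1 else 0)))).
    rewrite rmorph_sum; apply: eq_bigr => p _; rewrite eq_sym /act.
    case: ifP => _; last by rewrite !mulr0 raddf0 !rmorph0 mul0r.
    by rewrite mulr1 /= quot_map_pi rmorphM.
  have [_ sJ] := chain_subgroup Jch n.+1.
  apply: etrans (rmorph0 (quot_pi (IS n.+1))); apply/quot_piP; rewrite subr0.
  have h p : p \notin A ->
      J n.+1 (g' (coef u p) * (p.1 * (if x == p.2 then 1 else 0))).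
    move=> /hA up; have [_ [_ hJ]] := chain_open Jch n.+1.
    by apply: (hJ _ _ _).2; apply: g'JT; exists (coef u p).
  have := infsum_mod (null_familyM _ (coefP (lc_change g'c u)))
    (chain_subgroup Jch n.+1) h.
  rewrite -coef_lc_regroup u0 -[coef 0 x]/(0 : S) sub0r => /(sgN sJ).
  by rewrite opprK.
have /choice[w wP] : forall x, exists w, lc_in (JT n) w /\
    forall t y, q (coef (lc_unfold w) (t, y)) =
      if y == x then (val (ux x)@_t : right_module (quot_map (@gIT n.+1)))
      else 0.
  by move=> x; have [w wJ wE] := hx x; exists w.
(* Only the coordinates x that occur in [A] need a lift; elsewhere u already lies in T_(n+1). *)
pose D := [fset p.2 | p in A]%fset.
have [_ sJT] := chain_subgroup JTch n.
exists (\sum_(x <- D) w x).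
  by refine (sg_sum (lc_in_subgroup _ sJT) _) => x _; have [] := wP x.
move=> [t y]; rewrite lc_coefB (zmod_morphism_sum _ _ lc_unfoldB) lc_coef_sum.
apply/(quot_piP (IT n.+1)); rewrite -/q.
have -> : q (\sum_(x <- D) coef (lc_unfold (w x)) (t, y)) =
    \sum_(x <- D) if y == x then q (coef u (t, y)) else 0.
  apply: etrans (zmod_morphism_sum _ _ (@quot_pi_zmod_morphism _ (IT n.+1))) _.
  apply: eq_bigr => x _; have [_ wxE] := wP x; rewrite -/q wxE.
  by case: eqP => // ->; exact: uxE.
have [yD|yD] := boolP (y \in D).
  rewrite (bigD1_seq y) ?fset_uniq //= eqxx big1 ?addr0 // => x.
  by rewrite eq_sym => /negbTE ->.
rewrite qA; last by apply: contra yD => tA; apply/imfsetP; exists (t, y).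
by rewrite big1 // => x _; rewrite if_same.
Qed.

Lemma lc_unfold_onto (z : lincomb T (S * X)%type) :
  lc_regroup (lc_change g'c z) = 0 -> exists w, lc_unfold w = z.
Proof.
move=> z0.
have sJT k : is_subgroup (JT k) by have [] := chain_subgroup JTch k.
have [w _ wz] : exists2 w, lc_in (JT 0%N) w & lc_unfold w = z; last by exists w.
apply: (@successive_approximation _ _
  (fun k => @lc_in T (lc_kernel * X)%type (JT k))
  (fun k => @lc_in T (S * X)%type (JT k))
  [set z | lc_regroup (lc_change g'c z) = 0] lc_unfold) => //.
- by move=> k; exact: lc_in_subgroup.
- by move=> k v vJ y; apply: (chain_le JTch (leqnSn k)).
- exact: lc_chain_sep.
- exact: lc_chain_complete.
- by move=> k v vI; apply: lc_in_bind => //; exact: chain_open.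
- split=> [|u v /= u0 v0].
    rewrite /= (zmod_morphism0 (@lc_change_zmod_morphism _ _ g' g'c _)).
    exact: (zmod_morphism0 (@lc_bindB _ _ _ _)).
  rewrite /= lc_change_zmod_morphism.
  rewrite /lc_regroup (lc_bindB (@lc_pair S X)) -!/(lc_regroup _) u0 v0.
  exact: subrr.
- exact: lc_regroup_unfold.
- exact: lc_unfold_step.
- by case: JTch => _ _ _ -> y.
Qed.

End Decomposition.

(** * Contramodules over S and over R *)

Lemma lc_change_id (R : clinearRingType)
    (c : continuous (idfun : {rmorphism R -> R})) (X : choiceType)
    (u : lincomb R X) : lc_change c u = u.
Proof. exact: lincomb_eq. Qed.

Lemma lc_bind_scale (S : clinearRingType) (X : choiceType) (v : lincomb S S)
    (u : lincomb S X) : lc_bind v (fun t => t *: u) = lc_val v *: u.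
Proof.
apply: lincomb_eq => x; rewrite coef_lc_bind coefZ /lc_val -infsumMr.
  by congr infsum; apply/funext => t; rewrite mulrA.
exact: null_familyM (coefP v).
Qed.

Lemma lc_bind_id (S : clinearRingType) (X : choiceType)
    (r : lincomb S (lincomb S X)) :
  lc_bind r id = lc_mul r.
Proof. by rewrite /lc_bind lc_map_id. Qed.

Lemma lc_bind_unitr (S : clinearRingType) (X : choiceType) (r : lincomb S X) :
  lc_bind r (@lc_unit S X) = r.
Proof. by rewrite -[RHS]lc_map_id lc_mapE. Qed.

Lemma lc_bind_regroup (S : clinearRingType) (X Y : choiceType)
    (w : lincomb S (S * X)%type) (u : X -> lincomb S Y) :
  lc_bind (lc_regroup w) u = lc_bind w (fun p => p.1 *: u p.2).
Proof.
rewrite /lc_regroup lc_bindA; congr lc_bind; apply/funext => p.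
by rewrite /lc_pair lc_bindZ lc_bind_unit.
Qed.

Lemma csum_pair (S : clinearRingType) (P : contramodule S) (q : S * P) :
  csum (lc_pair q) (fun p => p) = q.1 *: (q.2 : contra_mod P).
Proof. by rewrite /lc_pair csumZ csum_unit. Qed.

(** The map out of the free contramodule on one generator that sends the generator to p. *)
Program Definition contra_orbit (S : clinearRingType) (P : contramodule S)
    (p : contra_mod P) : contra_hom (regular_contra S) P :=
  @ContraHom _ (regular_contra S) P (fun t : S => t *: p) _.
Next Obligation.
move=> S P p u /=; rewrite -[LHS]/(lc_val u *: p).
have E t : t *: p = csum (t *: lc_unit S (p : P)) (fun q => q).
  by rewrite csumZ csum_unit.
rewrite E -lc_bind_scale csum_bind; congr csum.
by apply/funext => t; rewrite -E.
Qed.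

Section ProflatEpi.
Variables (R S : clinearRingType) (f : {rmorphism R -> S}) (fc : continuous f).
Variable I : nat -> set R.
Let J n := closed_right_ideal_gen f (I n).
Hypotheses (Ich : ideal_chain I) (Jch : ideal_chain J).
Hypotheses (hflat : left_proflat f) (hepi : topological_ring_proepi f).

Lemma proflat_quot n (fIJ : f @` Ideal2 (chain_open Ich n).2
    `<=` Ideal2 (chain_open Jch n).2) :
  flat (restr_mod (quot_map fIJ) (quot_ring (Ideal2 (chain_open Jch n).2))^o).
Proof.
have [_ _ hfl] := hflat; apply: hfl => //.
  exact: (chain_open Ich n).1.
exact: (chain_open Jch n).1.
Qed.

(** The case T = S: here R/I_n -> S/J_n is an epimorphism because [f] is a proepimorphism. *)
Lemma lc_unfold_onto_target (X : choiceType) (z : lincomb S (S * X)%type) :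
  lc_regroup z = 0 ->
  exists w : lincomb S (lc_kernel fc * X)%type, lc_unfold fc w = z.
Proof.
move=> z0.
have idc : continuous (idfun : {rmorphism S -> S}) by move=> x; exact: cvg_id.
have fIJ n : f @` I n `<=` J n.
  by move=> _ [r Ir <-]; exact: sub_closed_right_ideal_gen.
have idJ n : idfun @` J n `<=` J n by move=> _ [s Js <-].
apply: (@lc_unfold_onto R S S f fc f fc idfun idc _ I J Ich Jch Jch fIJ idJ)
  => //.
- move=> n; apply: hepi.2; first exact: (chain_open Ich n).1.
  exact: (chain_open Jch n).1.
- exact: proflat_quot.
- by rewrite lc_change_id.
Qed.

(** The case T = R: the identity of R/I_n is trivially an epimorphism. *)
Lemma lc_unfold_onto_source (X : choiceType)
    (idc : continuous (idfun : {rmorphism R -> R}))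
    (z : lincomb R (S * X)%type) :
  lc_regroup (lc_change fc z) = 0 ->
  exists w : lincomb R (lc_kernel fc * X)%type, lc_unfold idc w = z.
Proof.
have fIJ n : f @` I n `<=` J n.
  by move=> _ [r Ir <-]; exact: sub_closed_right_ideal_gen.
have idI n : idfun @` I n `<=` I n by move=> _ [s Is <-].
apply: (@lc_unfold_onto R R S f fc idfun idc f fc _ I I Ich Jch Ich idI fIJ)
  => //.
- move=> n T u v uv a; rewrite -(quot_reprK a).
  by have := uv (quot_pi _ (quot_repr a)); rewrite /= !quot_map_pi.
- exact: proflat_quot.
Qed.

Let SR := contra_restr fc (regular_contra S).

(** A contramodule map h takes the value of v to the sum of the v_t h(t), and k has the same value
    as the zero combination. *)
Lemma csum_kernel (Q : contramodule R) (h : contra_hom SR Q)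
    (k : lc_kernel fc) :
  csum (val k) h = 0.
Proof.
have E (v : lincomb R S) : csum v h = h (lc_val (lc_change fc v)).
  exact/esym/(contra_funP h v).
rewrite E (eqP (valP k)) -(csum0l (P := Q) (I := S) h) E; congr (h _).
rewrite (zmod_morphism0 (@lc_change_zmod_morphism _ _ f fc _)).
by rewrite (zmod_morphism0 (@lc_val_zmod_morphism S)).
Qed.

Lemma lc_regroup_surj (X : choiceType) (u : lincomb S X) :
  exists v : lincomb R (S * X)%type, lc_regroup (lc_change fc v) = u.
Proof.
have [|v _ <-] := @lc_regroup_onto _ _ f fc I Ich Jch X 0%N u; last by exists v.
by move=> x; case: Jch => _ _ _; rewrite /J => ->.
Qed.

Lemma regular_hom_scale (Q : contramodule S)
    (h : contra_hom SR (contra_restr fc Q)) (t : S) :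
  h t = t *: (h (1 : S) : contra_mod Q) :> contra_mod Q.
Proof.
(* The relation [t] - t[1], placed over a one-point set. *)
pose z := lc_unit S (t, tt) - t *: lc_unit S (1 : S, tt).
have [|w wz] := @lc_unfold_onto_target unit z.
  rewrite /lc_regroup lc_bindB lc_bindZ !lc_bind_unit /lc_pair /=.
  by rewrite scale1r subrr.
pose p (q : S * unit) : Q := h q.1.
have : csum z p = 0.
  rewrite -wz /lc_unfold csum_bind -[RHS](csum0r Q w); congr csum.
  apply/funext => -[k x]; rewrite csum_map -csum_restr.
  apply: etrans (csum_kernel h k) _; congr (contra_pi Q _).
  exact: (zmod_morphism0 (@lc_change_zmod_morphism _ _ f fc _)).
rewrite /z csumB csumZ !csum_unit => /eqP; rewrite subr_eq0 => /eqP.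
exact.
Qed.

(** * Restriction of scalars is full *)

Section RestrHomLinear.
Variables (P Q : contramodule S).
Variable g : contra_hom (contra_restr fc P) (contra_restr fc Q).

(** Composing g with the orbit map of p reduces the claim to a map out of S. *)
Lemma restr_hom_scale t (p : P) :
  g (t *: (p : contra_mod P)) = t *: (g p : contra_mod Q) :> contra_mod Q.
Proof.
pose h := contra_comp g (contra_restr_hom fc (contra_orbit (p : contra_mod P))).
rewrite -[LHS]/(h t) regular_hom_scale; congr (_ *: _).
by rewrite /= scale1r.
Qed.

(** An infinite S-linear sum is an infinite R-linear sum of terms t p; g respects the latter by
    assumption and the terms by [restr_hom_scale]. *)
Lemma restr_hom_contra (u : lincomb S P) :
  g (contra_pi P u) = contra_pi Q (lc_map g u).
Proof.
have [v <-] := lc_regroup_surj u.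
have csumE (w : lincomb S P) :
  contra_pi Q (lc_map g w) = csum (P := Q) w (fun p : P => g p) by [].
rewrite contra_piE csumE /lc_regroup !csum_bind -!csum_restr.
rewrite contra_hom_csum; congr csum; apply/funext => q.
by rewrite csum_pair restr_hom_scale csumZ csum_unit.
Qed.

Definition unrestr_hom : contra_hom P Q := ContraHom restr_hom_contra.
End RestrHomLinear.

(** * The coinduced S-contramodule Hom(S, Q) *)

Section Coinduction.
Variable Q : contramodule R.

Definition coind : Type := contra_hom SR Q.
HB.instance Definition _ := gen_eqMixin coind.
HB.instance Definition _ := gen_choiceMixin coind.

Let ev (p : S * coind) : Q := (p.2 : contra_hom SR Q) p.1.

(** v is an R-linear combination of relations between elements of S, each paired with one h, and h
    kills them. Hence [coind_eval] does not depend on the expansion chosen. *)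
Lemma coind_csum0 (v : lincomb R (S * coind)%type) :
  lc_regroup (lc_change fc v) = 0 -> csum v ev = 0.
Proof.
have idc : continuous (idfun : {rmorphism R -> R}) by move=> x; exact: cvg_id.
move=> /(lc_unfold_onto_source idc)[w <-].
rewrite /lc_unfold csum_bind -[RHS](csum0r Q w); congr csum.
apply/funext => -[k h]; rewrite csum_map lc_change_id.
exact: (csum_kernel (h : contra_hom SR Q) k).
Qed.

(* The pairing of a formal combination of homs with coefficients s_h in S:
   the sum of the h(s_h), made convergent by expanding s_h over R. *)
Definition coind_eval (u : lincomb S coind) : contra_mod Q :=
  csum (projT1 (cid (lc_regroup_surj u))) ev.

Lemma coind_evalE (v : lincomb R (S * coind)%type) :
  coind_eval (lc_regroup (lc_change fc v)) = csum v ev.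
Proof.
rewrite /coind_eval; case: cid => v' /= vv'.
apply/eqP; rewrite -subr_eq0 -csumB; apply/eqP/coind_csum0.
rewrite lc_change_zmod_morphism /lc_regroup lc_bindB -!/(lc_regroup _) vv'.
exact: subrr.
Qed.

Lemma coind_eval_bind (X : choiceType) (v : lincomb R X)
    (u : X -> lincomb S coind) :
  coind_eval (lc_bind (lc_change fc v) u) = csum v (fun x => coind_eval (u x)).
Proof.
have /choice[y yP] := fun x => lc_regroup_surj (u x).
have -> : lc_bind (lc_change fc v) u = lc_regroup (lc_change fc (lc_bind v y)).
  rewrite lc_change_bind /lc_regroup lc_bindA; congr lc_bind.
  by apply/funext => x; rewrite -yP.
rewrite coind_evalE csum_bind; congr csum; apply/funext => x.
by rewrite -yP coind_evalE.
Qed.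

Lemma coind_eval_single t (h : coind) :
  coind_eval (t *: lc_unit S h) = (h : contra_hom SR Q) t.
Proof.
have := coind_evalE (lc_unit R (t, h)).
by rewrite lc_change_unit /lc_regroup lc_bind_unit csum_unit.
Qed.

(** S acts by right multiplication on the argument: the sum of the s_h h takes t to the sum of the
    h(t s_h). *)
Program Definition coind_pi (u : lincomb S coind) : coind :=
  @ContraHom R SR Q (fun t : S => coind_eval (t *: u)) _.
Next Obligation.
move=> u k.
transitivity (coind_eval (lc_val (lc_change fc k) *: u)); first by [].
by rewrite -lc_bind_scale coind_eval_bind.
Qed.

Lemma coind_pi_unit h : coind_pi (lc_unit S h) = h.
Proof. by apply: contra_hom_eq => t /=; exact: coind_eval_single. Qed.

Lemma coind_eval_assoc (r : lincomb S (lincomb S coind)) :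
  coind_eval (lc_map coind_pi r) = coind_eval (lc_mul r).
Proof.
have [v <-] := lc_regroup_surj r.
rewrite -lc_bind_id lc_mapE.
rewrite (lc_bind_regroup _ (fun u => lc_unit S (coind_pi u))).
rewrite (lc_bind_regroup _ id).
rewrite (coind_eval_bind v) (coind_eval_bind v (fun p => p.1 *: p.2)).
congr csum; apply/funext => p; exact: coind_eval_single.
Qed.

Lemma coind_pi_assoc r : coind_pi (lc_map coind_pi r) = coind_pi (lc_mul r).
Proof.
by apply: contra_hom_eq => t /=; rewrite -lc_mapZ -lc_mulZ coind_eval_assoc.
Qed.

Definition coind_contra : contramodule S :=
  Contramodule coind_pi_unit coind_pi_assoc.

Program Definition coind_counit : contra_hom (contra_restr fc coind_contra) Q :=
  @ContraHom R (contra_restr fc coind_contra) Q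
    (fun h : coind => (h : contra_hom SR Q) (1 : S)) _.
Next Obligation.
move=> u /=; rewrite scale1r -[lc_change fc u]lc_bind_unitr coind_eval_bind.
congr csum; apply/funext => h; rewrite -[lc_unit S h]scale1r.
exact: coind_eval_single.
Qed.

End Coinduction.

Hypothesis hff : fully_faithful (forgetful R).

(** Fullness of the forgetful functor, stated on underlying maps. *)
Lemma contra_hom_of_linear (P Q : contramodule R)
    (g : contra_mod P -> contra_mod Q) :
  linear g -> exists h : contra_hom P Q, forall p, h p = g p.
Proof.
move=> gL; pose gl : {linear contra_mod P -> contra_mod Q} :=
  HB.pack g (GRing.isLinear.Build _ _ _ _ g gL).
have [k _ /(_ gl) kg] := hff P Q; exists (k gl) => p.
have := congr1 (fun x : {linear contra_mod P -> contra_mod Q} =>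
  (x : contra_mod P -> contra_mod Q) p) kg.
exact.
Qed.

(** * The S-contramodule structure given by a compatible S-module structure *)

Section Extension.
Variables (Q : contramodule R) (s : S -> contra_mod Q -> contra_mod Q).
Hypothesis sP : induces_module f s.

Let D := coind_contra Q.

Lemma regular_restr_linear (M : lmodType R) (g : S -> M) :
  (forall a t u, g (f a * t + u) = a *: g t + g u) ->
  linear (g : contra_mod SR -> M).
Proof.
move=> gL a t u; rewrite -gL; congr g.
rewrite -[LHS]/(cm_add (cm_scale a t) u) /cm_add /cm_scale.
have E (v : lincomb R S) : contra_pi SR v = lc_val (lc_change fc v) by [].
have lcu x : lc_val (lc_unit S x) = x by exact: regular_unit.
have lcZ b x : lc_val (b *: lc_unit S x) = b * x.
  rewrite /lc_val (@infsum_single _ _ x) /= /lc_unit_coef ?eqxx ?mulr1 // => y.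
  by move=> /negbTE ->; rewrite mulr0 mul0r.
rewrite !E lc_changeD !lc_change_unit.
rewrite (zmod_morphismD (@lc_val_zmod_morphism S)).
by rewrite !lcu lc_changeZ lc_change_unit lcZ.
Qed.

(** Fullness is used twice: t |-> t q is R-linear in t, which places it in D, and q |-> (t |-> t q)
    is R-linear because t (a q) = (t f(a)) q. *)
Lemma coaction_ex : exists i : contra_hom Q (contra_restr fc D),
  forall q t, (i q : contra_hom SR Q) t = s t q.
Proof.
have [[sA s1 sD sd] sf] := sP.
have /choice[i0 i0P] : forall q : contra_mod Q, exists h : contra_hom SR Q,
    forall t : S, h t = s t q.
  move=> q; have [|h hP] := @contra_hom_of_linear SR Q (fun t => s t q);
    last by exists h.
  apply: regular_restr_linear => a t u.
  by rewrite sd -sA sf.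
have ev1 (h : coind Q) t :
    coind_eval (t *: lc_unit S h) = (h : contra_hom SR Q) t.
  exact: coind_eval_single.
have evD (u v : lincomb S (coind Q)) :
    coind_eval (u + v) = coind_eval u + coind_eval v.
  have [a <-] := lc_regroup_surj u; have [b <-] := lc_regroup_surj v.
  rewrite /lc_regroup -lc_bindD -!/(lc_regroup _) -lc_changeD !coind_evalE.
  exact: csumD.
have [|i iP] := @contra_hom_of_linear Q (contra_restr fc D) i0; last first.
  by exists i => q t; rewrite iP i0P.
move=> a p q; apply: contra_hom_eq => t.
rewrite i0P sD.
rewrite -[RHS]/(coind_eval (t *: lc_change fc (
  lc_unit R (cm_scale a (i0 p : contra_mod (contra_restr fc D)) : coind Q)
  + lc_unit R (i0 q : coind Q)))).
rewrite lc_changeD !lc_change_unit scalerDr evD !ev1 (i0P q).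
congr (_ + s t q : contra_mod Q).
rewrite -[RHS]/(coind_eval (t *: lc_change fc
  (a *: lc_unit R (i0 p : coind Q)))).
by rewrite lc_changeZ lc_change_unit scalerA ev1 (i0P p) -sA sf.
Qed.

Let i := projT1 (cid coaction_ex).
Let iE q t : (i q : contra_hom SR Q) t = s t q.
Proof. exact: (projT2 (cid coaction_ex)). Qed.

Let ev := coind_counit Q.
Let evi q : ev (i q) = q.
Proof. by have [[_ s1 _ _] _] := sP; rewrite /ev /= iE s1. Qed.

Let e := unrestr_hom (contra_comp i ev).
Let eE (d : D) : e d = i (ev d). Proof. by []. Qed.

(* Q is a retract of the S-contramodule D through i and ev, because the
   idempotent i ev is S-linear. *)
Let ext_pi (u : lincomb S Q) : Q :=
  ev (contra_pi D (lc_map (fun q => i q : D) u)).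

Lemma ext_unit (q : Q) : ext_pi (lc_unit S q) = q.
Proof. by rewrite /ext_pi lc_map_unit contra_unit evi. Qed.

Lemma ext_assoc (r : lincomb S (lincomb S Q)) :
  ext_pi (lc_map ext_pi r) = ext_pi (lc_mul r).
Proof.
pose a (u : lincomb S Q) : D := contra_pi D (lc_map (fun q => i q : D) u).
transitivity (ev (contra_pi D (lc_map e (lc_map a r)))).
  by rewrite /ext_pi -!lc_map_comp.
rewrite -contra_funP eE evi /ext_pi; congr (ev _).
rewrite -[in RHS]lc_bind_id lc_map_bind.
rewrite (lc_map_comp (contra_pi D) (lc_map (fun q => i q : D))) contra_assoc.
by rewrite /lc_bind.
Qed.

Definition ext_contra : contramodule S := Contramodule ext_unit ext_assoc.

Lemma ext_restr (u : lincomb R Q) :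
  contra_pi (contra_restr fc ext_contra) u = contra_pi Q u.
Proof.
rewrite -[LHS]/(ev (contra_pi D (lc_map (fun q => i q : D) (lc_change fc u)))).
rewrite -lc_change_map -[contra_pi D _]/(contra_pi (contra_restr fc D) _).
rewrite contra_funP -lc_map_comp -[in RHS](lc_map_id u).
congr (contra_pi Q (lc_map _ u)).
by apply/funext => q; rewrite evi.
Qed.

Lemma ext_scale t (q : Q) : t *: (q : contra_mod ext_contra) = s t q :> Q.
Proof.
rewrite -[LHS]/(ev (contra_pi D
  (lc_map (fun q => i q : D) (t *: lc_unit S q)))).
rewrite lc_mapZ lc_map_unit.
rewrite -[LHS]/(coind_eval ((1 : S) *: (t *: lc_unit S (i q)))).
by rewrite scale1r coind_eval_single iE.
Qed.

Lemma ext_add (p q : Q) :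
  (p : contra_mod ext_contra) + q = (p : contra_mod Q) + q :> Q.
Proof.
rewrite -[LHS]/(contra_pi ext_contra (lc_unit S p + lc_unit S q)).
rewrite -!(lc_change_unit fc) -lc_changeD.
exact: ext_restr.
Qed.

Program Definition ext_hom : contra_hom (contra_restr fc ext_contra) Q :=
  @ContraHom R (contra_restr fc ext_contra) Q id _.
Next Obligation. by move=> u; rewrite lc_map_id; exact: ext_restr. Qed.

Program Definition ext_hom_inv : contra_hom Q (contra_restr fc ext_contra) :=
  @ContraHom R Q (contra_restr fc ext_contra) id _.
Next Obligation. by move=> u; rewrite lc_map_id; exact/esym/ext_restr. Qed.

End Extension.

(** The identity of Q is an R-contramodule map between the two extensions, hence S-linear. *)
Lemma induced_action_unique (Q : contramodule R)
    (s s' : S -> contra_mod Q -> contra_mod Q) :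
  induces_module f s -> induces_module f s' -> s = s'.
Proof.
move=> sP s'P; apply/funext => t; apply/funext => q.
have := restr_hom_scale (contra_comp (ext_hom_inv s'P) (ext_hom sP)) t q.
by rewrite /= ext_scale => ->; rewrite ext_scale.
Qed.

End ProflatEpi.

(** * Pseudopullback *)

Section EquivalenceCriterion.
Variables (C D : category) (F : functor C D).
Hypothesis Fff : fully_faithful F.
Hypothesis Fes : forall y, in_essential_image F y.

Let preim_ex x y : exists g : hom (F x) (F y) -> hom x y,
  cancel (fun f : hom x y => fmap F f) g /\ cancel g (fun f => fmap F f).
Proof. by have [g fg gf] := Fff x y; exists g. Qed.

Let preim x y : hom (F x) (F y) -> hom x y := projT1 (cid (preim_ex x y)).
Let fmapK x y (h : hom (F x) (F y)) : fmap F (preim h) = h.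
Proof. by have [_] := projT2 (cid (preim_ex x y)); apply. Qed.
Let fmap_inj x y (h h' : hom x y) : fmap F h = fmap F h' -> h = h'.
Proof. exact: (bij_inj (Fff x y)). Qed.

(** Object, isomorphism and inverse are bundled so that a single choice yields a coherent triple. *)
Let counit_ex y : exists s : {x : C & (hom (F x) y * hom y (F x))%type},
  compc (projT2 s).2 (projT2 s).1 = idc _ /\
  compc (projT2 s).1 (projT2 s).2 = idc _.
Proof.
by have [x [f [g [fg gf]]]] := Fes y; exists (existT _ x (f, g)).
Qed.

Let ob y : C := projT1 (projT1 (cid (counit_ex y))).
Let counit y : hom (F (ob y)) y := (projT2 (projT1 (cid (counit_ex y)))).1.
Let counit_inv y : hom y (F (ob y)) := (projT2 (projT1 (cid (counit_ex y)))).2.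
Let counitK y : compc (counit_inv y) (counit y) = idc _.
Proof. by have [] := projT2 (cid (counit_ex y)). Qed.
Let counit_invK y : compc (counit y) (counit_inv y) = idc _.
Proof. by have [] := projT2 (cid (counit_ex y)). Qed.

Let inv_hom y z (h : hom y z) : hom (ob y) (ob z) :=
  preim (compc (counit_inv z) (compc h (counit y))).

Let inv_hom1 y : inv_hom (idc y) = idc (ob y).
Proof. by apply: fmap_inj; rewrite fmapK comp1c counitK fmap1. Qed.

Let inv_homM y z t (h' : hom z t) (h : hom y z) :
  inv_hom (compc h' h) = compc (inv_hom h') (inv_hom h).
Proof.
apply: fmap_inj; rewrite fmapM !fmapK -!compcA; congr compc.
by rewrite [compc (counit z) _]compcA counit_invK comp1c.
Qed.

Let inv_functor : functor D C := Functor inv_hom1 inv_homM.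

Lemma fully_faithful_equivalence : is_equivalence F.
Proof.
exists inv_functor; split; constructor; last first.
  refine (@NatIso _ _ (comp_functor F inv_functor) (id_functor D) counit _ _).
    by move=> y z h /=; rewrite fmapK !compcA counit_invK comp1c.
  move=> y; exists (counit_inv y).
  by split; [exact: counitK|exact: counit_invK].
refine (@NatIso _ _ (comp_functor inv_functor F) (id_functor C)
  (fun x => preim (counit (F x))) _ _).
  move=> x y h /=; apply: fmap_inj; rewrite !fmapM !fmapK !compcA.
  by rewrite counit_invK comp1c.
move=> x; exists (preim (counit_inv (F x))).
by split; apply: fmap_inj; rewrite fmapM !fmapK fmap1 ?counitK ?counit_invK.
Qed.
End EquivalenceCriterion.

Lemma ppb_hom_iso (A B C : category) (F : functor A C) (G : functor B C)
    (x y : ppb_obj F G) (h : ppb_hom x y) :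
  is_iso (ppb_hom_fst h) -> is_iso (ppb_hom_snd h) ->
  is_iso (h : @hom (pseudopullback F G) x y).
Proof.
move=> [u [uh hu]] [v [vh hv]].
(* The inverse components respect the glueing: compose the square of h with both inverses. *)
have sq : compc (fmap G v) (ppb_glue y) = compc (ppb_glue x) (fmap F u).
  have := ppb_hom_square h.
  move=> /(congr1 (fun k => compc (fmap G v) (compc k (fmap F u)))).
  rewrite !compcA -fmapM vh fmap1 comp1c -[compc (compc _ _) (fmap F u)]compcA.
  by rewrite -[compc _ (compc _ (fmap F u))]compcA -fmapM hu fmap1 compc1 => ->.
by exists (PpbHom sq); split; apply: ppb_hom_eq.
Qed.

Lemma transported_action (A B : pzRingType) (f : {rmorphism A -> B})
    (M : lmodType A) (N : lmodType B) (phi : {linear M -> restr_mod f N})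
    (psi : {linear restr_mod f N -> M}) :
  cancel phi psi -> cancel psi phi ->
  induces_module f (fun t m => psi (t *: (phi m : N) : N)).
Proof.
move=> phiK psiK; split=> [|a v]; last first.
  transitivity (psi (phi (a *: v))); last exact: phiK.
  by congr (psi _); rewrite linearZ.
split=> [a b v|v|a u v|v a b].
- by rewrite psiK scalerA.
- by rewrite scale1r phiK.
- rewrite (raddfD phi) -[RHS]raddfD; congr (psi _).
  exact: (scalerDr a (phi u : N)).
- transitivity (psi (a *: (phi v : N) + b *: (phi v : N) : N)).
    by rewrite scalerDl.
  exact: (raddfD psi).
Qed.

Section RestrOperations.
Variables (R S : clinearRingType) (f : {rmorphism R -> S}) (fc : continuous f).
Variable P : contramodule S.

Lemma contra_restr_add (p q : P) :
  (p : contra_mod (contra_restr fc P)) + q = (p : contra_mod P) + q :> P.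
Proof.
rewrite -[LHS]/(contra_pi P (lc_change fc (lc_unit R p + lc_unit R q))).
by rewrite lc_changeD !lc_change_unit.
Qed.

Lemma contra_restr_scale a (p : P) :
  a *: (p : contra_mod (contra_restr fc P)) = f a *: (p : contra_mod P) :> P.
Proof.
rewrite -[LHS]/(contra_pi P (lc_change fc (a *: lc_unit R p))).
by rewrite lc_changeZ lc_change_unit.
Qed.
End RestrOperations.

Theorem corollary9p6 (R S : clinearRingType) (f : {rmorphism R -> S})
    (fc : continuous f)
    (hR : has_countable_base R) (hS : has_countable_base S)
    (hflat : left_proflat f) (hepi : topological_ring_proepi f)
    (hff : fully_faithful (forgetful R)) :
  [/\ fully_faithful (contra_restr_functor fc),
      forall Q : contramodule R,
        in_essential_image (contra_restr_functor fc) Q <->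
        exists s : S -> contra_mod Q -> contra_mod Q, induces_module f s,
      forall (Q : contramodule R) (s s' : S -> contra_mod Q -> contra_mod Q),
        induces_module f s -> induces_module f s' -> s = s',
      is_pseudopullback (forgetful_square fc) &
      fully_faithful (forgetful R) /\ fully_faithful (forgetful S)].
Proof.
have [_ taut _] := hflat.
have [I Ich Jch] := taut_chain hR fc taut.
have sharp_ff : fully_faithful (contra_restr_functor fc).
  move=> P Q; exists (unrestr_hom Ich Jch hflat hepi (P := P) (Q := Q)) => g.
    exact: contra_hom_eq.
  exact: contra_hom_eq.
(* An S-linear map is R-linear, so by [hff] an R-contramodule map, so by [unrestr_hom] an
   S-contramodule map. *)
have forget_ff : fully_faithful (forgetful S).
  move=> P Q.
  have gex (g : {linear contra_mod P -> contra_mod Q}) :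
      exists h : contra_hom P Q, forall p, h p = g p.
    have [|h hE] := @contra_hom_of_linear R hff (contra_restr fc P)
      (contra_restr fc Q) (g : P -> Q).
      move=> a p q; rewrite contra_restr_add !contra_restr_scale.
      by rewrite contra_restr_add linearP.
    by exists (unrestr_hom Ich Jch hflat hepi h).
  exists (fun g => projT1 (cid (gex g))) => [h|g].
    by apply: contra_hom_eq => p; exact: (projT2 (cid (gex _))).
  by apply: linear_eq => p; exact: (projT2 (cid (gex _))).
split=> //.
- move=> Q; split=> [[P [h [k [kh hk]]]]|[s sP]]; last first.
    exists (ext_contra fc Ich Jch hflat hepi hff sP).
    exists (ext_hom fc Ich Jch hflat hepi hff sP).
    exists (ext_hom_inv fc Ich Jch hflat hepi hff sP).
    by split; exact: contra_hom_eq.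
  (* For Q in the essential image, the action is carried over from P along the given isomorphism. *)
  pose psi := (contra_mod_hom h
    \o (@square_inv_fun _ _ f fc P : {linear _ -> _})
    : {linear restr_mod f (contra_mod P) -> contra_mod Q}).
  pose phi := (square_hom fc P \o contra_mod_hom k
    : {linear contra_mod Q -> restr_mod f (contra_mod P)}).
  exists (fun t q => psi (t *: (phi q : contra_mod P))).
  apply: transported_action => q.
    exact: (congr1 (fun g : contra_hom Q Q => g q) hk).
  have := congr1 (fun g : contra_hom (contra_restr fc P) (contra_restr fc P) =>
    g q) kh.
  exact.
- move=> Q s s'.
  exact: (@induced_action_unique R S f fc I Ich Jch hflat hepi hff Q s s').
(* A morphism in the pseudopullback is determined by its first component, since the glueing maps
   here are identities on elements; that component lifts along f_sharp. *)
- apply: fully_faithful_equivalence => [P Q|[A B phi [psi [phiK psiK]]]].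
    exists (fun k : ppb_hom (ppb_comparison (forgetful_square fc) P)
        (ppb_comparison (forgetful_square fc) Q) =>
      unrestr_hom Ich Jch hflat hepi
        (ppb_hom_fst k : contra_hom (contra_restr fc P) (contra_restr fc Q)))
      => [g|k].
      exact: contra_hom_eq.
    apply: ppb_hom_eq; first exact: contra_hom_eq.
    apply: linear_eq => p; have := ppb_hom_square k.
    move=> /(congr1 (fun g : {linear contra_mod (contra_restr fc P)
      -> restr_mod f (contra_mod Q)} => g p)) e.
    exact: esym e.
  have pK x : psi (phi x) = x.
    exact: (congr1 (fun g : {linear contra_mod A -> contra_mod A} => g x) phiK).
  have qK x : phi (psi x) = x.
    exact: (congr1 (fun g : {linear restr_mod f B -> restr_mod f B} => g x)
      psiK).
  (* For essential surjectivity, the S-module structure of [B] is carried to [A] along [phi]; the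
     S-contramodule [Q] so obtained restricts to [A], and [phi] becomes S-linear from [Q] to [B]. *)
  have sP := transported_action pK qK.
  pose Q := ext_contra fc Ich Jch hflat hepi hff sP.
  have phiL : linear (phi : contra_mod Q -> B).
    move=> a p q; transitivity (phi (psi (a *: (phi p : B) : B) + q)).
      congr (phi _); apply: etrans
        (@ext_add R S f fc I Ich Jch hflat hepi hff A _ sP (a *: p) q) _.
      exact: (congr1 (fun x : contra_mod A => x + q)
        (@ext_scale R S f fc I Ich Jch hflat hepi hff A _ sP a p)).
    by rewrite raddfD; congr (_ + _); exact: qK.
  have psiL : linear (psi : B -> contra_mod Q).
    by move=> a b c; rewrite -[RHS]pK; congr (psi _); rewrite phiL !qK.
  pose phiS : {linear contra_mod Q -> B} :=
    HB.pack (phi : contra_mod Q -> B) (GRing.isLinear.Build _ _ _ _ _ phiL).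
  pose psiS : {linear B -> contra_mod Q} :=
    HB.pack (psi : B -> contra_mod Q) (GRing.isLinear.Build _ _ _ _ _ psiL).
  pose eta := ext_hom fc Ich Jch hflat hepi hff sP.
  have sq : compc (fmap (restr_functor f) (phiS : hom (forgetful S Q) B))
      (forgetful_square fc Q) =
    compc (phi : hom (forgetful R A) (restr_functor f B))
      (fmap (forgetful R) eta).
    exact: linear_eq.
  exists Q, (@PpbHom _ _ _ (forgetful R) (restr_functor f)
    (ppb_comparison (forgetful_square fc) Q)
    (PpbObj (ex_intro _ psi (conj phiK psiK))) eta phiS sq).
  apply: ppb_hom_iso => /=.
    exists (ext_hom_inv fc Ich Jch hflat hepi hff sP).
    by split; exact: contra_hom_eq.
  exists psiS; split; apply: linear_eq; [exact: pK|exact: qK].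
Qed.
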